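(* If $\mathfrak{X}$ is a Fraïssé structure, then the following are equivalent: (1) For every $\mathfrak{A}$ and $\mathfrak{B}$ in $\operatorname{Age}(\mathfrak{X})$ and every $f : \binom{\mathfrak{X}}{\mathfrak{A}} \to \{0,1\}$, there is a $\beta \in \left\langle {\mathfrak{X} \atop \mathfrak{B}} \right\rangle$ such that for every $\alpha, \alpha' \in \left\langle {\beta \atop \mathfrak{A}} \right\rangle$, $|f(\alpha) - f(\alpha')| \leq 1/2$. (2) $\operatorname{Age}(\mathfrak{X})$ satisfies the convex Ramsey property: for every $\mathfrak{A}$ and $\mathfrak{B}$ in $\operatorname{Age}(\mathfrak{X})$ there is a $\mathfrak{C}$ in $\operatorname{Age}(\mathfrak{X})$ such that $\mathfrak{C} \rightarrow \langle \mathfrak{B} \rangle^{\mathfrak{A}}_2$. (3) There is a $p < 1$ such that for every $\mathfrak{A}$ and $\mathfrak{B}$ in $\operatorname{Age}(\mathfrak{X})$ there is a $\mathfrak{C}$ in $\operatorname{Age}(\mathfrak{X})$ such that for every $f : \binom{\mathfrak{C}}{\mathfrak{A}} \to [0,1]$, there is a $\beta \in \left\langle {\mathfrak{C} \atop \mathfrak{B}} \right\rangle$ such that for every $\alpha, \alpha' \in \left\langle {\beta \atop \mathfrak{A}} \right\rangle$, $|f(\alpha) - f(\alpha')| \leq p$. (4) For every $\mathfrak{A}$ and $\mathfrak{B}$ in $\operatorname{Age}(\mathfrak{X})$ and every $\epsilon > 0$, there is a $\mathfrak{C}$ in $\operatorname{Age}(\mathfrak{X})$ such that for every $f : \binom{\mathfrak{C}}{\mathfrak{A}}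 \to [0,1]$, there is a $\beta \in \left\langle {\mathfrak{C} \atop \mathfrak{B}} \right\rangle$ such that for every $\alpha, \alpha' \in \left\langle {\beta \atop \mathfrak{A}} \right\rangle$, $|f(\alpha) - f(\alpha')| \leq \epsilon$. (5) For every $\mathfrak{A}$ and $\mathfrak{B}$ in $\operatorname{Age}(\mathfrak{X})$, every $\epsilon > 0$, and every $n$, there is a $\mathfrak{C}$ in $\operatorname{Age}(\mathfrak{X})$ such that for every sequence $f_i$ $(i < n)$ of functions from $\binom{\mathfrak{C}}{\mathfrak{A}}$ to $[0,1]$, there is a $\beta \in \left\langle {\mathfrak{C} \atop \mathfrak{B}} \right\rangle$ such that for every $\alpha, \alpha' \in \left\langle {\beta \atop \mathfrak{A}} \right\rangle$ and every $i < n$, $|f_i(\alpha) - f_i(\alpha')| \leq \epsilon$. (6) $\operatorname{Aut}(\mathfrak{X})$ is amenable (as a topological group).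
   Context: A Fraïssé structure is a countable relational structure which is ultrahomogeneous: every finite partial automorphism (isomorphism between finite substructures) extends to an automorphism of the whole structure. $\operatorname{Age}(\mathfrak{X})$ is the collection of finite substructures of $\mathfrak{X}$. For structures $\mathfrak{A}$, $\mathfrak{B}$ in the same language, $\binom{\mathfrak{B}}{\mathfrak{A}}$ is the set of all embeddings of $\mathfrak{A}$ into $\mathfrak{B}$, and $\left\langle {\mathfrak{B} \atop \mathfrak{A}} \right\rangle$ is the set of all finitely supported probability measures on $\binom{\mathfrak{B}}{\mathfrak{A}}$, i.e. finite formal convex combinations of embeddings. A function $f : \binom{\mathfrak{B}}{\mathfrak{A}} \to \mathbb{R}$ is extended linearly to the vector space generated by $\binom{\mathfrak{B}}{\mathfrak{A}}$, in particular to $\left\langle {\mathfrak{B} \atop \mathfrak{A}} \right\rangle$; the extension is also denoted $f$. Composition $\circ$ of embeddings is extended bilinearly to formal linear combinations. For $\beta \in \left\langle {\mathfrak{C} \atop \mathfrak{B}} \right\rangle$ (where $\mathfrak{C}$ is $\mathfrak{X}$ or a finite substructure of it), $\left\langle {\beta \atop \mathfrak{A}} \right\rangle = \{\beta \circ \alpha : \alpha \in \left\langle {\mathfrak{B} \atop \mathfrak{A}} \right\rangle\}$, a subset of $\left\langle {\mathfrak{C} \atop \mathfrak{A}} \right\rangle$. $\mathfrak{C} \rightarrow \langle \mathfrak{B} \rangle^{\mathfrak{A}}_k$ means: whenever $f : \binom{\mathfrak{C}}{\mathfrak{A}} \to \{0,\ldots,k-1\}$, there is a $\beta \in \left\langle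 {\mathfrak{C} \atop \mathfrak{B}} \right\rangle$ such that $|f(\alpha) - f(\alpha')| \leq 1/2$ for all $\alpha, \alpha' \in \left\langle {\beta \atop \mathfrak{A}} \right\rangle$. $\operatorname{Aut}(\mathfrak{X})$ carries the topology of pointwise convergence (as a group of permutations of the discrete underlying set of $\mathfrak{X}$). A topological group $G$ is amenable if whenever $G$ acts continuously on a (nonempty) compact Hausdorff space $K$, $K$ supports a Borel probability measure which is preserved by the action of $G$. The natural numbers include $0$, and $i<n$ ranges over $0,\ldots,n-1$. *)

(* Defs.v *)
From HB Require Import structures.
From mathcomp Require Import all_boot all_order all_algebra finmap.
From mathcomp Require Import all_classical all_reals all_analysis.
From mathcomp Require Import freeg.

Set Implicit Arguments.
Unset Strict Implicit.
Unset Printing Implicit Defensive.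
Import Order.TTheory GRing.Theory Num.Theory.

Local Open Scope classical_set_scope.
Local Open Scope ring_scope.

Record language := Language { symbol :> Type; arity : symbol -> nat }.

Record structure (L : language) := Structure {
  carrier :> choiceType;
  interp : forall s : L, set ((arity s).-tuple carrier)
}.

Definition substructure (L : language) (M : structure L) (A : {fset M}) :
    structure L :=
  @Structure L A (fun s t => interp (map_tuple (@fsval M A) t)).

Definition is_embedding (L : language) (M N : structure L) (f : M -> N) : Prop :=
  injective f /\
  forall (s : L) (t : (arity s).-tuple M),
    interp t <-> interp (map_tuple f t).

Record embedding (L : language) (M N : structure L) := Embedding {
  embedding_fun :> M -> N;
  embeddingP : is_embedding embedding_fun
}.

HB.instance Definition _ (L : language) (M N : structure L) :=
  gen_eqMixin (embedding M N).
HB.instance Definition _ (L : language) (M N : structure L) :=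
  gen_choiceMixin (embedding M N).

Lemma embedding_ext (L : language) (M N : structure L) (e f : embedding M N) :
  e =1 f -> e = f.
Proof.
case: e f => [e eP] [f fP] /= /funext ef; case: _ / ef in fP *.
by congr Embedding; exact: Prop_irrelevance.
Qed.

Lemma is_embedding_id (L : language) (M : structure L) :
  is_embedding (id : M -> M).
Proof.
by split=> // s t; rewrite (_ : map_tuple id t = t)//; apply: val_inj; exact: map_id.
Qed.

Lemma map_tuple_comp (T U V : Type) n (g : U -> V) (f : T -> U)
    (t : n.-tuple T) : map_tuple (g \o f) t = map_tuple g (map_tuple f t).
Proof. by apply: val_inj; rewrite /= map_comp. Qed.

Lemma is_embedding_comp (L : language) (M N P : structure L)
    (g : embedding N P) (f : embedding M N) : is_embedding (g \o f).
Proof.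
have [gi gr] := embeddingP g; have [fi fr] := embeddingP f.
split=> [|s t]; first exact: inj_comp.
by rewrite map_tuple_comp; apply: iff_trans (fr _ _) (gr _ _).
Qed.

Definition embedding_comp (L : language) (M N P : structure L)
    (g : embedding N P) (f : embedding M N) : embedding M P :=
  Embedding (is_embedding_comp g f).

Record automorphism (L : language) (M : structure L) := Automorphism {
  automorphism_embedding :> embedding M M;
  automorphism_bij : bijective automorphism_embedding
}.

HB.instance Definition _ (L : language) (M : structure L) :=
  gen_eqMixin (automorphism M).
HB.instance Definition _ (L : language) (M : structure L) :=
  gen_choiceMixin (automorphism M).

Lemma automorphism_ext (L : language) (M : structure L) (g h : automorphism M) :
  g =1 h -> g = h.
Proof.
case: g h => [g gP] [h hP] /= /embedding_ext gh; case: _ / gh in hP *.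
by congr Automorphism; exact: Prop_irrelevance.
Qed.

Section AutomorphismGroup.
Context (L : language) (M : structure L).
Implicit Types g h k : automorphism M.

Let id_embedding : embedding M M := Embedding (is_embedding_id M).

Definition aut_one : automorphism M :=
  @Automorphism L M id_embedding (inv_bij (fun=> erefl)).

Definition aut_mul g h : automorphism M :=
  @Automorphism L M (embedding_comp g h)
    (bij_comp (automorphism_bij g) (automorphism_bij h)).

Lemma aut_has_inv g : exists h, cancel g h /\ cancel h g.
Proof.
have [f gf fg] := automorphism_bij g; have [_ gr] := embeddingP g.
have fe : is_embedding f.
  split=> [|s t]; first exact: can_inj fg.
  have tE : t = map_tuple g (map_tuple f t).
    by apply: val_inj; rewrite /= -map_comp map_id_in// => x _ /=; exact: fg.
  by rewrite [in X in X <-> _]tE; apply: iff_sym (gr _ _).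
by exists (@Automorphism L M (Embedding fe) (Bijective fg gf)).
Qed.

Definition aut_inv g : automorphism M := sval (cid (aut_has_inv g)).

Lemma aut_invK g : cancel g (aut_inv g).
Proof. by rewrite /aut_inv; case: cid => h []. Qed.

Lemma aut_Kinv g : cancel (aut_inv g) g.
Proof. by rewrite /aut_inv; case: cid => h []. Qed.

Lemma aut_mulA : associative aut_mul.
Proof. by move=> g h k; exact: automorphism_ext. Qed.

Lemma aut_mul1 : left_id aut_one aut_mul.
Proof. by move=> g; exact: automorphism_ext. Qed.

Lemma aut_1mul : right_id aut_one aut_mul.
Proof. by move=> g; exact: automorphism_ext. Qed.

Lemma aut_mulV : left_inverse aut_one aut_inv aut_mul.
Proof. by move=> g; apply: automorphism_ext => x /=; exact: aut_invK. Qed.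

Lemma aut_Vmul : right_inverse aut_one aut_inv aut_mul.
Proof. by move=> g; apply: automorphism_ext => x /=; exact: aut_Kinv. Qed.

HB.instance Definition _ := isGroup.Build (automorphism M)
  aut_mulA aut_mul1 aut_1mul aut_mulV aut_Vmul.

HB.instance Definition _ := Topological.copy (automorphism M)
  (initial_topology
     (fun g : automorphism M => (g : {ptws M -> discrete_topology M}))).

End AutomorphismGroup.

HB.mixin Record isTopologicalGroup G & Group G & Topological G := {
  mulg_continuous : continuous (fun x : G * G => (x.1 * x.2)%g);
  invg_continuous : continuous (fun x : G => (x^-1)%g)
}.

#[short(type="topologicalGroupType")]
HB.structure Definition TopologicalGroup :=
  {G of Group G & Topological G & isTopologicalGroup G}.

Section AutomorphismTopology.
Context (L : language) (M : structure L).
Implicit Types g h : automorphism M.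

Let T := discrete_topology M.

Lemma nbhs_aut g (x : M) : nbhs g [set h | h x = g x].
Proof.
pose u := fun h : automorphism M => (h : {ptws M -> T}).
have u_cont : continuous u by exact: (@initial_continuous _ {ptws M -> T}).
have eval_cont : continuous (fun f : {ptws M -> T} => f x).
  exact: (@proj_continuous M (fun=> T) x).
exact: (continuous_comp (u_cont g) (eval_cont (u g))) (discrete_set1 _).
Qed.

Lemma cvg_aut (F : set_system (automorphism M)) g : Filter F ->
  (forall x, F [set h | h x = g x]) -> F --> g.
Proof.
move=> FF Fg.
have cvF : (fun h : automorphism M => (h : {ptws M -> T})) @ F -->
    (g : {ptws M -> T}).
  apply/cvg_sup => x; apply/cvg_image.
    by rewrite eqEsubset; split=> v // _; exists (cst v).
  move=> A /principal_filterP Agx; exists [set f : M -> T | A (f x)].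
    by apply: filterS (Fg x) => h /= ->.
  by rewrite eqEsubset; split=> [_ [f Af <-]//|v Av]; exists (cst v).
move=> A /= [_ [[B Bop <-] Bg sBA]].
have gB : nbhs (g : {ptws M -> T}) B by exact: open_nbhs_nbhs.
exact: (@filterS _ F FF _ _ sBA (cvF _ gB)).
Qed.

Lemma aut_mul_continuous :
  continuous (fun x : automorphism M * automorphism M => (x.1 * x.2)%g).
Proof.
move=> [g h]; apply: (cvg_aut (fmap_filter _ _)) => x /=.
exists ([set k : automorphism M | k (h x) = g (h x)],
        [set k : automorphism M | k x = h x]).
  by split; exact: nbhs_aut.
by move=> [k l] /= [kE lE]; rewrite lE kE.
Qed.

Lemma aut_inv_continuous : continuous (fun g : automorphism M => (g^-1)%g).
Proof.
move=> g; apply: (cvg_aut (fmap_filter _ (nbhs_filter g))) => x /=.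
apply: filterS (nbhs_aut g ((g^-1)%g x)) => h /= hE.
by apply: (can_inj (aut_invK h)); rewrite hE !aut_Kinv.
Qed.

HB.instance Definition _ := isTopologicalGroup.Build (automorphism M)
  aut_mul_continuous aut_inv_continuous.

End AutomorphismTopology.

Definition continuous_action (G : topologicalGroupType) (K : topologicalType)
    (act : G -> K -> K) : Prop :=
  [/\ forall x, act 1%g x = x,
      forall g h x, act (g * h)%g x = act g (act h x) &
      continuous (fun p : G * K => act p.1 p.2)].

(* [ptopologicalType] is a nonempty space with a distinguished point; the
   library puts generated sigma-algebras on pointed types only. *)
Definition amenable (R : realType) (G : topologicalGroupType) : Prop :=
  forall (K : ptopologicalType) (act : G -> K -> K),
    compact [set: K] -> hausdorff_space K -> continuous_action act ->
    exists mu : probability (g_sigma_algebraType (@open K)) R,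
      forall (g : G) (A : set (g_sigma_algebraType (@open K))),
        measurable A -> mu (act g @^-1` A) = mu A.

Definition ultrahomogeneous (L : language) (X : structure L) : Prop :=
  forall (A B : {fset X}) (e : embedding (substructure A) (substructure B)),
    bijective e ->
    exists g : automorphism X, forall a : A, g (fsval a) = fsval (e a).

Definition fraisse (L : language) (X : structure L) : Prop :=
  countable [set: X] /\ ultrahomogeneous X.

(* The vector space generated by the embeddings of A into B is
   {freeg (embedding A B) / R}. *)
Definition convex_combinations (R : realType) (L : language)
    (A B : structure L) : set {freeg (embedding A B) / R} :=
  [set a | (forall e, 0 <= coeff e a) /\ \sum_(e <- dom a) coeff e a = 1].
Arguments convex_combinations R {L} A B _.

Definition linear_extension (R : realType) (L : language) (A B : structure L)
    (f : embedding A B -> R) (a : {freeg (embedding A B) / R}) : R :=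
  fglift (f : embedding A B -> R^o) a.

Definition linear_comp (R : realType) (L : language) (A B C : structure L)
    (b : {freeg (embedding B C) / R}) (a : {freeg (embedding A B) / R}) :
    {freeg (embedding A C) / R} :=
  fglift (fun g => fglift (fun e => << embedding_comp g e >>) a) b.

Definition convex_copies (R : realType) (L : language) (A B C : structure L)
    (b : {freeg (embedding B C) / R}) : set {freeg (embedding A C) / R} :=
  linear_comp b @` convex_combinations R A B.
Arguments convex_copies {R L} A {B C} b _.

(* The partition relation written C -> <B>^A_k. *)
Definition convex_arrow (R : realType) (L : language) (C B A : structure L)
    (k : nat) : Prop :=
  forall f : embedding A C -> 'I_k,
    exists2 b, convex_combinations R B C b &
      forall a a', convex_copies A b a -> convex_copies A b a' ->
        `|linear_extension (fun e => (f e)%:R) a -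
          linear_extension (fun e => (f e)%:R) a'| <= 1 / 2.

Definition age_convex_ramsey (R : realType) (L : language) (X : structure L) :
    Prop :=
  forall A B : {fset X}, exists C : {fset X},
    convex_arrow R (substructure C) (substructure B) (substructure A) 2.

(* Main.v *)
(* The oscillation of f on the polytope <beta; A> is attained at its vertices
   beta o e.  (1) => (2) is compactness: bad colorings of all finite C converge
   along an ultrafilter to a bad coloring of X.  (2) => (3) rounds f at 1/2, and
   (3) => (4) => (5) iterate, composing the resulting betas.

   (5) => (6): let Aut(X) act on K and let x0 be a point of K.  For f in C(K),
   uniformly in h, the value f(h^-1 x0) depends up to eps only on the restriction
   of h to a finite A, so it is nearly a function on the embeddings of A.  A
   convex combination of embeddings stabilizing it gives a combination of the
   points h^-1 x0 whose mean of f is nearly invariant under finitely many group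
   elements.  The limit of these finitely supported means along an ultrafilter is
   an invariant positive functional on C(K), and its Riesz measure is invariant.

   (6) => (1): take an invariant measure mu on the orbit closure of f in
   2^Emb(A, X).  By homogeneity mu {phi | phi e = 1} is the same number for all e.
   Every pattern on the finite set Emb(A, B) that has positive mass is realized in
   the orbit of f, by some g_p; the combination of the g_p^-1 restricted to B,
   weighted by the masses of the patterns, makes f constant. *)
From HB Require Import structures.
Require Import Defs.
From mathcomp Require Import all_boot all_order all_algebra finmap.
From mathcomp Require Import all_classical all_reals all_analysis.
From mathcomp Require Import freeg lra.

Set Implicit Arguments.
Unset Strict Implicit.
Unset Printing Implicit Defensive.
Import Order.TTheory GRing.Theory Num.Theory.
Import numFieldNormedType.Exports.

Local Open Scope classical_set_scope.
Local Open Scope ring_scope.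

(** * Convex combinations of embeddings *)

Section FreeLinear.
Context (R : nzRingType) (K : choiceType) (M : lmodType R) (f : K -> M).

Lemma fgliftE (D : {freeg K / R}) :
  fglift f D = \sum_(z <- dom D) coeff z D *: f z.
Proof. by rewrite -{1}(Freeg_dom D) fglift_Freeg /prelift big_map. Qed.

Lemma fglift0 : fglift f 0 = 0.
Proof. by rewrite -(subrr 0) lift_is_additive subrr. Qed.

Lemma fglift_add (D1 D2 : {freeg K / R}) :
  fglift f (D1 + D2) = fglift f D1 + fglift f D2.
Proof.
have fB := lift_is_additive f.
have fN D : fglift f (- D) = - fglift f D.
  by rewrite -[in LHS](sub0r D) fB fglift0 sub0r.
by rewrite -[D2 in LHS]opprK fB fN opprK.
Qed.

Lemma fglift_sum I (s : seq I) (F : I -> {freeg K / R}) :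
  fglift f (\sum_(i <- s) F i) = \sum_(i <- s) fglift f (F i).
Proof. exact: (big_morph _ fglift_add fglift0). Qed.

Lemma fglift_scale c (D : {freeg K / R}) : fglift f (c *: D) = c *: fglift f D.
Proof.
rewrite [c *: D]/(GRing.scale c D)/= /fgscale fglift_sum fgliftE scaler_sumr.
by apply: eq_bigr => z _; rewrite liftU scalerA.
Qed.

End FreeLinear.

Lemma fglift_comp (R : nzRingType) (K K' : choiceType) (M : lmodType R)
    (f : K' -> M) (h : K -> {freeg K' / R}) (D : {freeg K / R}) :
  fglift f (fglift h D) = fglift (fun z => fglift f (h z)) D.
Proof.
rewrite (fgliftE h) fglift_sum fgliftE.
by apply: eq_bigr => z _; rewrite fglift_scale.
Qed.

Section ConvexCombinations.
Context (R : realType) (L : language).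
Implicit Types (A B C : structure L).

Lemma linear_extensionE A B (f : embedding A B -> R)
    (a : {freeg (embedding A B) / R}) :
  linear_extension f a = \sum_(e <- dom a) coeff e a * f e.
Proof. by rewrite /linear_extension fgliftE. Qed.

Lemma linear_extension_unit A B (f : embedding A B -> R) e :
  linear_extension f << e >> = f e.
Proof. by rewrite /linear_extension liftU /= scale1r. Qed.

Lemma linear_extension_sum A B (f : embedding A B -> R) I (s : seq I)
    (w : I -> R) (g : I -> embedding A B) :
  linear_extension f (\sum_(i <- s) << w i *g g i >>) =
  \sum_(i <- s) w i * f (g i).
Proof.
rewrite /linear_extension fglift_sum.
by apply: eq_bigr => i _; rewrite liftU.
Qed.

(** Both sides are the double sum of [coeff g b * coeff e a * f (g o e)]; only the order of
    summation differs. *)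
Lemma linear_extension_comp A B C (f : embedding A C -> R)
    (b : {freeg (embedding B C) / R}) (a : {freeg (embedding A B) / R}) :
  linear_extension f (linear_comp b a) =
  linear_extension
    (fun e => linear_extension (fun g => f (embedding_comp g e)) b) a.
Proof.
rewrite {1}/linear_extension /linear_comp fglift_comp.
under [X in fglift X _]eq_fun do rewrite fglift_comp.
rewrite linear_extensionE fgliftE.
under eq_bigr do rewrite fgliftE scaler_sumr.
rewrite exchange_big/=; apply: eq_bigr => e _.
rewrite linear_extensionE mulr_sumr; apply: eq_bigr => g _.
by rewrite liftU scale1r /= mulrCA.
Qed.

Lemma convex_combinationsP A B (a : {freeg (embedding A B) / R}) :
  convex_combinations R A B a <->
  (forall e, 0 <= coeff e a) /\ linear_extension (fun=> 1) a = 1.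
Proof.
rewrite linear_extensionE /convex_combinations /=.
by under [in X in _ <-> X]eq_bigr do rewrite mulr1.
Qed.

Lemma convex_combinations_sum A B I (s : seq I) (w : I -> R)
    (g : I -> embedding A B) :
  (forall i, 0 <= w i) -> \sum_(i <- s) w i = 1 ->
  convex_combinations R A B (\sum_(i <- s) << w i *g g i >>).
Proof.
move=> w0 w1; apply/convex_combinationsP; split=> [e|].
  by rewrite /coeff fglift_sum sumr_ge0// => i _; rewrite liftU mulr_ge0.
by rewrite linear_extension_sum; under eq_bigr do rewrite mulr1.
Qed.

Lemma convex_combinations_unit A B (e : embedding A B) :
  convex_combinations R A B << e >>.
Proof.
rewrite -[<< e >>](big_seq1 +%R tt (fun=> << 1 *g e >>)).
by apply: convex_combinations_sum => // ; rewrite big_seq1.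
Qed.

Lemma convex_combinations_comp A B C (b : {freeg (embedding B C) / R})
    (a : {freeg (embedding A B) / R}) :
  convex_combinations R B C b -> convex_combinations R A B a ->
  convex_combinations R A C (linear_comp b a).
Proof.
move=> /convex_combinationsP[b0 b1] /convex_combinationsP[a0 a1].
apply/convex_combinationsP; split=> [e|]; last first.
  by rewrite linear_extension_comp b1 a1.
(* A coefficient is the linear extension of an indicator function, so its sign can be read off the
   double sum. *)
rewrite -[coeff _ _]/(linear_extension (fun g => (g == e)%:R) (linear_comp b a)).
rewrite linear_extension_comp linear_extensionE sumr_ge0// => g _.
by rewrite mulr_ge0// linear_extensionE sumr_ge0// => h _; rewrite mulr_ge0.
Qed.

Lemma linear_extension_affine A B (f : embedding A B -> R) c d
    (a : {freeg (embedding A B) / R}) : convex_combinations R A B a ->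
  linear_extension (fun e => c * f e + d) a = c * linear_extension f a + d.
Proof.
move=> /convex_combinationsP[_ a1].
rewrite -[d in RHS]mulr1 -[X in d * X]a1 !linear_extensionE !mulr_sumr -big_split/=.
by apply: eq_bigr => e _; rewrite mulrDr mulrCA mulr1 (mulrC d).
Qed.

Lemma ler_linear_extension A B (f g : embedding A B -> R)
    (a : {freeg (embedding A B) / R}) : convex_combinations R A B a ->
  (forall e, f e <= g e) -> linear_extension f a <= linear_extension g a.
Proof.
move=> [a0 _] fg; rewrite !linear_extensionE ler_sum// => e _.
by rewrite ler_wpM2l.
Qed.

Lemma linear_extension_cst A B (a : {freeg (embedding A B) / R}) d :
  convex_combinations R A B a -> linear_extension (fun=> d) a = d.
Proof.
by case=> _ a1; rewrite linear_extensionE -mulr_suml a1 mul1r.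
Qed.

(** The value of [f] at the vertex [b o e] of the polytope [<b; A>]. As [e] varies it is again a
    function on embeddings, so stabilization can be iterated. *)
Definition average A B C (f : embedding A C -> R)
    (b : {freeg (embedding B C) / R}) (e : embedding A B) : R :=
  linear_extension (fun g => f (embedding_comp g e)) b.

Lemma average_comp A B C D (f : embedding A D -> R)
    (b : {freeg (embedding C D) / R}) (c : {freeg (embedding B C) / R})
    (e : embedding A B) :
  average f (linear_comp b c) e = average (average f b) c e.
Proof.
rewrite /average linear_extension_comp.
congr linear_extension; apply/funext => g; congr linear_extension.
by apply/funext => h; congr f; apply: embedding_ext.
Qed.

Lemma average_itv A B C (f : embedding A C -> R)
    (b : {freeg (embedding B C) / R}) (e : embedding A B) u v :
  convex_combinations R B C b ->
  (forall g, u <= f g <= v) -> u <= average f b e <= v.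
Proof.
move=> cb fuv; apply/andP; split.
  rewrite -(linear_extension_cst u cb); apply: ler_linear_extension => // g.
  by case/andP: (fuv (embedding_comp g e)).
rewrite -(linear_extension_cst v cb); apply: ler_linear_extension => // g.
by case/andP: (fuv (embedding_comp g e)).
Qed.

(* The oscillation of [f] on the polytope of copies [<b; A>] is attained at its
   vertices. *)
Lemma convex_copies_osc A B C (f : embedding A C -> R)
    (b : {freeg (embedding B C) / R}) eps :
  (forall a a', convex_copies A b a -> convex_copies A b a' ->
     `|linear_extension f a - linear_extension f a'| <= eps) <->
  (forall e e' : embedding A B, `|average f b e - average f b e'| <= eps).
Proof.
split=> [osc e e'|osc _ _ [a ca <-] [a' ca' <-]].
  have := osc (linear_comp b << e >>) (linear_comp b << e' >>).
  rewrite !linear_extension_comp !linear_extension_unit; apply.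
    by exists << e >> => //; exact: convex_combinations_unit.
  by exists << e' >> => //; exact: convex_combinations_unit.
rewrite !linear_extension_comp -!/(average f b).
(* By symmetry a one-sided bound suffices. Averaging over [c] bounds [u] by each single vertex value
   plus [eps]; averaging over [c'] then finishes. *)
have half c c' : convex_combinations R A B c -> convex_combinations R A B c' ->
    linear_extension (average f b) c - linear_extension (average f b) c' <= eps.
  move=> cc cc'; set u := linear_extension _ c.
  have le_u e' : u <= 1 * average f b e' + eps.
    rewrite mul1r -(linear_extension_cst (average f b e' + eps) cc).
    apply: ler_linear_extension => // e; rewrite -lerBlDl.
    exact: le_trans (ler_norm _) (osc _ _).
  rewrite lerBlDl -[X in X + _]mul1r -linear_extension_affine//.
  by rewrite -(linear_extension_cst u cc'); exact: ler_linear_extension.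
rewrite ler_norml half// andbT -lerN2 opprK opprB; exact: half.
Qed.

End ConvexCombinations.

(** * Iterated stabilization *)

(** [f] is compared at [g o e] and [g o e'] for the same [g], term by term. Hence what is already
    stable stays stable under later averaging. *)
Lemma average_osc (R : realType) (L : language) (A B C : structure L)
    (f : embedding A C -> R) (b : {freeg (embedding B C) / R}) eps :
  convex_combinations R B C b ->
  (forall e e', `|f e - f e'| <= eps) ->
  forall e e' : embedding A B, `|average f b e - average f b e'| <= eps.
Proof.
move=> cb osc e e'.
have half h h' : average f b h <= average f b h' + eps.
  rewrite -[X in X + _]mul1r -linear_extension_affine//.
  apply: ler_linear_extension => // g; rewrite mul1r -lerBlDl.
  exact: le_trans (ler_norm _) (osc _ _).
by rewrite ler_norml lerBlDl half andbT lerBrDl lerBlDr.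
Qed.

(** Spelled as in the theorem so that its clauses convert to it; proofs use the vertex form
    [stabilizesP]. *)
Definition stabilizes (R : realType) (L : language) (A B C : structure L)
    (f : embedding A C -> R) (eps : R) : Prop :=
  exists2 b, convex_combinations R B C b &
    forall a a', convex_copies A b a -> convex_copies A b a' ->
      `|linear_extension f a - linear_extension f a'| <= eps.
Arguments stabilizes {R L A} B {C} f eps.

Definition simultaneous_ramsey (R : realType) (L : language) (X : structure L) :
    Prop :=
  forall (A B : {fset X}) (eps : R) (n : nat), 0 < eps ->
  exists C : {fset X},
    forall f : 'I_n -> embedding (substructure A) (substructure C) -> R,
    (forall i e, 0 <= f i e <= 1) ->
    exists2 b, convex_combinations R (substructure B) (substructure C) b &
      forall i (e e' : embedding (substructure A) (substructure B)),
        `|average (f i) b e - average (f i) b e'| <= eps.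

Section Stabilization.
Context (R : realType) (L : language).
Implicit Types (A B C : structure L).

Lemma stabilizesP A B C (f : embedding A C -> R) eps :
  stabilizes B f eps <->
  exists2 b, convex_combinations R B C b &
    forall e e' : embedding A B, `|average f b e - average f b e'| <= eps.
Proof.
by split=> -[b cb osc]; exists b => //; exact/convex_copies_osc.
Qed.

Lemma stabilizesW A B C (f : embedding A C -> R) eps eps' : eps <= eps' ->
  stabilizes B f eps -> stabilizes B f eps'.
Proof.
move=> le_eps [b cb osc]; exists b => // a a' ba ba'.
exact: le_trans (osc _ _ ba ba') le_eps.
Qed.

Definition id_embedding A : embedding A A := Embedding (is_embedding_id A).

(* Rounding at 1/2: [f] lies between [r / 2] and [r / 2 + 1 / 2], where [r] is
   the rounded function. *)
Lemma stabilizes_round A B C : convex_arrow R C B A 2 ->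
  forall f : embedding A C -> R, (forall e, 0 <= f e <= 1) ->
  stabilizes B f (3 / 4).
Proof.
move=> arrow f f01; pose r e : 'I_2 := inord (1 / 2 <= f e)%R.
have rE e : (r e)%:R = (1 / 2 <= f e)%R%:R :> R by rewrite inordK//; case: (_ <= _).
have [b cb /convex_copies_osc osc] := arrow r.
apply/stabilizesP; exists b => // e e'.
have lb h : 2^-1 * average (fun e => (r e)%:R) b h + 0 <= average f b h.
  rewrite -linear_extension_affine//; apply: ler_linear_extension => // g.
  rewrite rE; have /andP[] := f01 (embedding_comp g h).
  by case: (leP (1 / 2) (f _)) => /= ? ? ?; lra.
have ub h : average f b h <= 2^-1 * average (fun e => (r e)%:R) b h + 2^-1.
  rewrite -linear_extension_affine//; apply: ler_linear_extension => // g.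
  rewrite rE; have /andP[] := f01 (embedding_comp g h).
  by case: (leP (1 / 2) (f _)) => /= ? ? ?; lra.
(* Halving reduces the oscillation [1 / 2] of [r] to [1 / 4], and the rounding error adds at most
   [1 / 2]. *)
have := osc e e'; rewrite !ler_norml => /andP[? ?].
have := lb e; have := lb e'; have := ub e; have := ub e' => *.
by apply/andP; split; lra.
Qed.

Lemma stabilizes_comp A B C D (f : embedding A D -> R) b eps :
  convex_combinations R C D b ->
  stabilizes B (average f b : embedding A C -> R) eps -> stabilizes B f eps.
Proof.
move=> cb /stabilizesP[c cc osc]; apply/stabilizesP.
exists (linear_comp b c); first exact: convex_combinations_comp.
by move=> e e'; rewrite !average_comp.
Qed.

Lemma stabilizes_affine A B C (f : embedding A C -> R) c d eps : 0 < c ->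
  stabilizes B (fun e => c * f e + d) eps -> stabilizes B f (c^-1 * eps).
Proof.
move=> c0 /stabilizesP[b cb osc]; apply/stabilizesP; exists b => // e e'.
have := osc e e'; rewrite /average !linear_extension_affine//.
rewrite opprD addrACA subrr addr0 -mulrBr normrM gtr0_norm//.
by rewrite mulrC -ler_pdivlMr// mulrC.
Qed.

(** The map [t |-> p^-1 * (t - u)] carries the range into the unit interval, and oscillations scale
    back by [p]. *)
Lemma stabilizes_range A B C (f : embedding A C -> R) u p eps :
  0 < p -> (forall e, u <= f e <= u + p) ->
  (forall g : embedding A C -> R, (forall e, 0 <= g e <= 1) ->
     stabilizes B g eps) ->
  stabilizes B f (p * eps).
Proof.
move=> p0 fu H; rewrite -[p in p * _]invrK.
apply: (@stabilizes_affine _ _ _ _ _ (- (p^-1 * u))); first by rewrite invr_gt0.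
apply: H => e; rewrite -mulrBr; have /andP[? ?] := fu e.
rewrite mulr_ge0 ?subr_ge0 ?invr_ge0 ?(ltW p0)//=.
by rewrite mulrC ler_pdivrMr// mul1r lerBlDl.
Qed.

Lemma osc_range A C (f : embedding A C -> R) p : 0 <= p ->
  (forall e e', `|f e - f e'| <= p) ->
  exists u, forall e, u <= f e <= u + p.
Proof.
(* [u] is the infimum of the range; without embeddings any number will do. *)
move=> p0 osc; have [[e0 _]|ne] := pselect ([set: embedding A C] !=set0); last first.
  by exists 0 => e; case: ne; exists e.
have ub e : lbound (range f) (f e - p).
  move=> _ [e' _ <-]; rewrite lerBlDr -lerBlDl.
  exact: le_trans (ler_norm _) (osc _ _).
have ne0 : range f !=set0 by exists (f e0); exists e0.
exists (inf (range f)) => e; apply/andP; split.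
  by apply: ge_inf; [exists (f e0 - p); exact: ub|exists e].
by rewrite -lerBlDr lb_le_inf.
Qed.

Context (X : structure L).

Let stable_age (eps : R) := forall A B : {fset X}, exists C : {fset X},
  forall f : embedding (substructure A) (substructure C) -> R,
    (forall e, 0 <= f e <= 1) -> stabilizes (substructure B) f eps.

(** Two stages: some [C] stabilizes [f] to oscillation [p] on a [C'] that serves for exponent [n];
    the averaged function, rescaled from its range of length [p], is then stabilized to
    [p * p ^+ n]. *)
Lemma stable_age_exp (p : R) : 0 < p -> stable_age p -> forall n, stable_age (p ^+ n).
Proof.
move=> p0 stab; elim=> [|n IHn] A B.
  (* Exponent [0] asks for oscillation at most [1], which the identity of [B] already gives. *)
  exists B => f f01; apply/stabilizesP; exists << id_embedding _ >>.
    exact: convex_combinations_unit.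
  move=> e e'; rewrite /average !linear_extension_unit ler_norml expr0.
  have /andP[? ?] := f01 (embedding_comp (id_embedding _) e).
  have /andP[? ?] := f01 (embedding_comp (id_embedding _) e').
  by apply/andP; split; lra.
have [C' C'P] := IHn A B; have [C CP] := stab A C'.
exists C => f f01; have /stabilizesP[b cb osc] := CP f f01.
apply: (stabilizes_comp cb); have [u fu] := osc_range (ltW p0) osc.
by rewrite exprS; apply: stabilizes_range fu _.
Qed.

Lemma stable_age_small (p : R) : p < 1 -> stable_age p ->
  forall eps, 0 < eps -> stable_age eps.
Proof.
(* [p] may be zero or negative; raising it to at least [1 / 2] allows the rescaling, and the powers
   of [q] still tend to [0]. *)
move=> p1 stab eps eps0; pose q := Num.max p 2^-1.
have q0 : 0 < q by rewrite lt_max invr_gt0 ltr0n orbT.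
have q1 : q < 1 by rewrite gt_max p1 invf_lt1// ltr1n.
have stabq : stable_age q.
  move=> A B; have [C CP] := stab A B; exists C => f f01.
  by apply: stabilizesW (CP f f01); rewrite le_max lexx.
have [n qn] : exists n, q ^+ n <= eps.
  have := @cvg_expr R q; rewrite gtr0_norm// => /(_ q1)/cvgrPdist_le/(_ _ eps0).
  move=> [n _ /(_ n (leqnn n))] /=.
  rewrite sub0r normrN ger0_norm; last by rewrite exprn_ge0 ?ltW.
  by exists n.
move=> A B; have [C CP] := stable_age_exp q0 stabq n A B.
by exists C => f f01; apply: stabilizesW (CP f f01).
Qed.

(** The first function is stabilized on a [C'] serving for the remaining [n], whose averages are
    then stabilized together; by [average_osc] the first does not get worse. *)
Lemma stable_age_family (eps : R) : stable_age eps ->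
  forall (n : nat) (A B : {fset X}), exists C : {fset X},
  forall f : 'I_n -> embedding (substructure A) (substructure C) -> R,
    (forall i e, 0 <= f i e <= 1) ->
    exists2 b, convex_combinations R (substructure B) (substructure C) b &
      forall i (e e' : embedding (substructure A) (substructure B)),
        `|average (f i) b e - average (f i) b e'| <= eps.
Proof.
move=> stab; elim=> [|n IHn] A B.
  exists B => f _; exists << id_embedding _ >>; last by case.
  exact: convex_combinations_unit.
have [C' C'P] := IHn A B; have [C CP] := stab A C'.
exists C => f f01; have /stabilizesP[b cb osc] := CP (f ord0) (f01 ord0).
have [|c cc oscc] := C'P (fun i => average (f (fintype.lift ord0 i)) b).
  by move=> i e; apply: average_itv.
exists (linear_comp b c); first exact: convex_combinations_comp.
move=> i e e'; rewrite !average_comp; case: (unliftP ord0 i) => [j|] ->.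
  exact: oscc.
exact: average_osc.
Qed.

End Stabilization.

(** * Compactness *)

Lemma filter_seq (T : Type) (F : set_system T) (I : eqType) (s : seq I)
    (P : I -> set T) : Filter F ->
  (forall i, i \in s -> F (P i)) -> F [set t | forall i, i \in s -> P i t].
Proof.
move=> FF; elim: s => [_|i s IHs FP].
  by rewrite (_ : [set _ | _] = setT); [exact: filterT|apply/seteqP; split].
apply: filterS (filterI (FP i (mem_head i s)) (IHs _)) => [t [Pi Ps] j|j sj].
  by rewrite inE => /predU1P[->//|]; exact: Ps.
by apply: FP; rewrite inE sj orbT.
Qed.

Section FiniteSubstructures.
Context (L : language) (X : structure L).
Implicit Types (A B C : {fset X}).

Lemma finite_embeddings A B :
  finite_set [set: embedding (substructure A) (substructure B)].
Proof.
pose F (e : embedding (substructure A) (substructure B)) : {ffun A -> B} :=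
  [ffun a => e a].
have Finj : injective F.
  move=> e e' /ffunP ee'; apply: embedding_ext => a.
  by have := ee' a; rewrite !ffunE.
have := @finite_finset _ [set: {ffun A -> B}].
by move=> /(finite_preimage (in2W Finj)); rewrite preimage_setT.
Qed.

Lemma is_embedding_incl C : is_embedding (@fsval X C : substructure C -> X).
Proof. by split; [exact: val_inj|]. Qed.

Definition incl C : embedding (substructure C) X := Embedding (is_embedding_incl C).

Lemma incl_comp_inj (M : structure L) C (h h' : embedding M (substructure C)) :
  embedding_comp (incl C) h = embedding_comp (incl C) h' -> h = h'.
Proof.
move=> /(congr1 (@embedding_fun _ _ _)) hh'; apply: embedding_ext => x.
by apply: val_inj; exact: (congr1 (@^~ x) hh').
Qed.

Lemma corestrict (M : structure L) C (g : embedding M X) :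
  (forall x, g x \in C) ->
  exists h : embedding M (substructure C), embedding_comp (incl C) h = g.
Proof.
move=> gC.
have gE t : map_tuple (@fsval X C) (map_tuple (fun x => [` gC x]%fset) t) =
    map_tuple g t :> (_.-tuple _).
  by rewrite -map_tuple_comp.
have hP : is_embedding (fun x => [` gC x]%fset : substructure C).
  have [gi gr] := embeddingP g; split=> [x y /(congr1 (@fsval X C))/= /gi//|s t].
  by rewrite gr -gE.
by exists (Embedding hP); apply: embedding_ext => x.
Qed.

End FiniteSubstructures.

Section Compactness.
Context (R : realType) (L : language) (X : structure L).

Lemma infinite_to_finite_ramsey :
  (forall (A B : {fset X}) (f : embedding (substructure A) X -> 'I_2),
    stabilizes (substructure B) (fun e => (f e)%:R : R) (1 / 2)) ->
  age_convex_ramsey R X.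
Proof.
move=> ramsey A B; apply: contrapT => noC.
have bad (C : {fset X}) :
    exists f : embedding (substructure A) (substructure C) -> 'I_2,
    ~ stabilizes (substructure B) (fun e => (f e)%:R : R) (1 / 2).
  apply: contrapT => good; apply: noC; exists C => f.
  by apply: contrapT => ?; apply: good; exists f.
pose fin (C : {fset X}) := sval (cid (bad C)).
pose cone (D : {fset X}) := [set C | (D `<=` C)%fset].
(* Cones are directed under union, so they extend to an ultrafilter [U]: almost every [C] includes
   any given finite set. *)
have cone_proper : ProperFilter (filter_from setT cone).
  apply: filter_from_proper; last by move=> D _; exists D; exact: fsubset_refl.
  apply: filter_fromT_filter => [|D D']; first by exists fset0.
  by exists (D `|` D')%fset => C; rewrite /cone/= fsubUset => /andP[].
have [U [UU sU]] := ultraFilterLemma cone_proper.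
(* [f] is the limit of the bad colorings along [U]: every [e] factors through almost every [C], and
   almost all [fin C] give it the same color. *)
pose T (e : embedding (substructure A) X) :=
  [set C | exists2 h, embedding_comp (incl C) h = e & fin C h = 1].
pose f e : 'I_2 := if pselect (U (T e)) then 1 else 0.
have agree e : U [set C | forall h, embedding_comp (incl C) h = e -> fin C h = f e].
  rewrite /f; case: pselect => UTe /=.
    apply: filterS UTe => C [h he fh] h'.
    by rewrite -[in X in X -> _]he => /incl_comp_inj ->.
  have [//|UnT] := in_ultra_setVsetC (T e) UU.
  apply: filterS UnT => C nT h he; apply: contrapT => f0; apply: nT; exists h => //.
  move: f0; case: (fin C h) => -[|[|//]] i; last by move=> _; exact: val_inj.
  by case; exact: val_inj.
have /stabilizesP[b cb osc] := ramsey A B f.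
have /finite_seqP[s sE] := finite_embeddings A B.
pose pairs := [seq (g, e) | g <- dom b, e <- s].
have FU : Filter U by typeclasses eauto.
have Uagree := filter_seq (s := pairs) FU
  (fun p _ => agree (embedding_comp p.1 p.2)).
(* [D] collects the images of the embeddings in the support of [b]; above [D] all of them factor
   through [C]. *)
pose D := [fset x in [seq (g : embedding (substructure B) X)
  (y : substructure B) | g <- dom b, y <- enum {: B}]]%fset.
have UD : U (cone D) by apply: sU; exists D.
have [C [CD Cagree]] := filter_ex (filterI UD Uagree).
have corestr g : g \in dom b ->
    exists h : embedding (substructure B) (substructure C),
      embedding_comp (incl C) h = g.
  move=> gb; apply: corestrict => x; apply: (fsubsetP CD).
  by rewrite in_fset; apply/allpairsP; exists (g, x); rewrite gb mem_enum.
(* The weights sum to [1], so the support is inhabited; [h0] is the default value off the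
   support. *)
have [g0 g0b] : exists g, g \in dom b.
  have [_] := cb; case: (dom b) => [|g l _]; last by exists g; exact: mem_head.
  by rewrite big_nil => /esym/eqP; rewrite oner_eq0.
have [h0 _] := corestr g0 g0b.
have /choice[h hE] g : exists h : embedding (substructure B) (substructure C),
    g \in dom b -> embedding_comp (incl C) h = g.
  have [/corestr[h]|gb] := boolP (g \in dom b); first by exists h.
  by exists h0.
(* Moving [b] into [C] leaves all averages unchanged, so [fin C] is stabilized, against its
   choice. *)
apply: (svalP (cid (bad C))); rewrite -/(fin C); apply/stabilizesP.
exists (\sum_(g <- dom b) << coeff g b *g h g >>).
  by case: cb => b0 b1; exact: convex_combinations_sum.
have avgE e : average (fun e => (fin C e)%:R : R)
    (\sum_(g <- dom b) << coeff g b *g h g >>) e =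
    average (fun e => (f e)%:R) b e.
  rewrite /average linear_extension_sum linear_extensionE.
  apply: eq_big_seq => g gb; congr (_ * _%:R); congr (nat_of_ord _).
  apply: (Cagree (g, e)) => /=.
    have : [set: embedding (substructure A) (substructure B)] e by [].
    by rewrite sE /= => es; apply/allpairsP; exists (g, e).
  rewrite -[in RHS](hE g gb); exact: embedding_ext.
by move=> e e'; rewrite !avgE.
Qed.

End Compactness.

(** * Measures from positive functionals *)

Section PositiveFunctional.
Context (R : realType) (K : topologicalType) (I : (K -> R) -> R).

Definition subordinate (U : set K) : set (K -> R) :=
  [set f : K -> R | [/\ continuous f, forall x, 0 <= f x <= 1 &
               forall x, ~ U x -> f x = 0]].

(** The Riesz-Markov formula for the measure of an open set; [outer_mass] extends it to all sets by
    outer regularity. *)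
Definition inner_mass (U : set K) : R := sup [set I f | f in subordinate U].

Definition outer_mass (A : set K) : \bar R :=
  ereal_inf [set (inner_mass U)%:E | U in [set U | open U /\ A `<=` U]].

(* [(f - eps)^+] vanishes off the compact set [{f >= eps}]: cutting stands in for
   the compact supports of the usual proof. *)
Definition cut (eps : R) (f : K -> R) (x : K) : R := Num.max (f x - eps) 0.

Lemma cut_ge0 eps (f : K -> R) x : 0 <= cut eps f x.
Proof. by rewrite le_max lexx orbT. Qed.

Lemma cut_eq0 eps (f : K -> R) x : f x < eps -> cut eps f x = 0.
Proof. by rewrite -subr_lt0 => /ltW ?; exact: max_r. Qed.

Lemma le_cut eps (f : K -> R) x : f x <= cut eps f x + eps.
Proof. by rewrite -lerBlDr le_max lexx. Qed.

Lemma cut_le eps (f : K -> R) x : 0 <= eps -> 0 <= f x -> cut eps f x <= f x.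
Proof. by move=> eps0 f0; rewrite ge_max f0 andbT gerBl. Qed.

Lemma continuous_cut eps (f : K -> R) : continuous f -> continuous (cut eps f).
Proof.
move=> cf x; apply: (@continuous_comp _ _ _ (fun x => f x - eps) (Num.max^~ 0)).
  by apply: cvgB; [exact: cf|exact: cvg_cst].
have -> : (fun x : R => Num.max x 0) = (fun x => 2^-1 * (x + `|x|)).
  by apply/funext => y; rewrite maxr_absE subr0 addr0 mulrC.
apply: cvgM; first exact: cvg_cst.
by apply: cvgD; [exact: cvg_id|exact: norm_continuous].
Qed.

Lemma closed_superlevel eps (f : K -> R) : continuous f ->
  closed [set x | eps <= f x].
Proof.
move=> cf; rewrite (_ : [set x | _] = f @^-1` [set y | eps <= y])//.
by apply: closed_comp => [x _|]; [exact: cf|exact: closed_ge].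
Qed.

Hypothesis I_add : forall f g : K -> R, continuous f -> continuous g ->
  I (f \+ g) = I f + I g.
Hypothesis I_ge0 : forall f : K -> R, continuous f ->
  (forall x, 0 <= f x) -> 0 <= I f.
Hypothesis I_cst : forall c, I (fun=> c) = c.

Lemma functional_le (f g : K -> R) : continuous f -> continuous g ->
  (forall x, f x <= g x) -> I f <= I g.
Proof.
move=> cf cg fg; have cgf : continuous (g \- f).
  by move=> x; apply: cvgB; [exact: cg|exact: cf].
have -> : g = f \+ (g \- f) by apply/funext => x /=; rewrite addrC subrK.
by rewrite I_add// lerDl I_ge0// => x /=; rewrite subr_ge0.
Qed.

Lemma functional_cut (f : K -> R) eps : continuous f -> I f <= I (cut eps f) + eps.
Proof.
move=> cf; rewrite -[X in _ + X]I_cst.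
have cc : continuous ((fun=> eps) : K -> R) by move=> x; exact: cst_continuous.
rewrite -I_add//; last exact: continuous_cut.
apply: functional_le => //; last by move=> x; exact: le_cut.
by move=> x; apply: cvgD (cc x); exact: continuous_cut.
Qed.

Lemma subordinate0 U : subordinate U (fun=> 0).
Proof. by split => // x; [exact: cst_continuous|rewrite lexx ler01]. Qed.

Lemma inner_mass_has_sup U : has_sup [set I f | f in subordinate U].
Proof.
split; first by exists (I (fun=> 0)), (fun=> 0) => //; exact: subordinate0.
exists 1 => _ [f [cf f01 _] <-]; rewrite -[leRHS]I_cst.
by apply: functional_le => // x; [exact: cst_continuous|case/andP: (f01 x)].
Qed.

Lemma le_inner_mass U f : subordinate U f -> I f <= inner_mass U.
Proof.
by move=> fU; apply: ub_le_sup; [case: (inner_mass_has_sup U)|exists f].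
Qed.

Lemma inner_mass_le U c :
  (forall f, subordinate U f -> I f <= c) -> inner_mass U <= c.
Proof.
move=> H; apply: ge_sup; first by case: (inner_mass_has_sup U).
by move=> _ [f fU <-]; exact: H.
Qed.

Lemma inner_massS U V : U `<=` V -> inner_mass U <= inner_mass V.
Proof.
move=> UV; apply: inner_mass_le => f [cf f01 f0]; apply: le_inner_mass.
by split=> // x Vx; apply: f0 => /UV.
Qed.

Lemma inner_mass_ge0 U : 0 <= inner_mass U.
Proof. by rewrite -[leLHS]I_cst; apply: le_inner_mass; exact: subordinate0. Qed.

Lemma inner_massT : inner_mass setT = 1.
Proof.
apply/eqP; rewrite eq_le; apply/andP; split.
  apply: inner_mass_le => f [cf f01 _]; rewrite -[leRHS]I_cst.
  by apply: functional_le => // x; [exact: cst_continuous|case/andP: (f01 x)].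
rewrite -[leLHS]I_cst; apply: le_inner_mass; split => [||x].
- exact: cst_continuous.
- by rewrite ler01 lexx.
- by case.
Qed.

Lemma inner_mass0 : inner_mass set0 = 0.
Proof.
apply/eqP; rewrite eq_le inner_mass_ge0 andbT; apply: inner_mass_le => f [_ _ f0].
by rewrite (_ : f = fun=> 0) ?I_cst//; apply/funext => x; exact: f0.
Qed.

Lemma outer_mass_open U : open U -> outer_mass U = (inner_mass U)%:E.
Proof.
move=> oU; apply/eqP; rewrite eq_le; apply/andP; split.
  by apply: ereal_inf_lbound; exists U; split.
by apply: le_ereal_inf_tmp => _ [V [oV UV] <-]; rewrite lee_fin inner_massS.
Qed.

Lemma outer_mass_le A U : open U -> A `<=` U ->
  (outer_mass A <= (inner_mass U)%:E)%E.
Proof. by move=> oU AU; apply: ereal_inf_lbound; exists U. Qed.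

Lemma outer_mass_ge0 A : (0 <= outer_mass A)%E.
Proof. by apply: le_ereal_inf_tmp => _ [U _ <-]; rewrite lee_fin inner_mass_ge0. Qed.

Lemma outer_mass_fin A : outer_mass A \is a fin_num.
Proof.
rewrite fin_real// (lt_le_trans _ (outer_mass_ge0 A)) ?ltNyr//=.
by rewrite (le_lt_trans (outer_mass_le openT _) (ltry _)).
Qed.

Lemma outer_massS A B : A `<=` B -> (outer_mass A <= outer_mass B)%E.
Proof.
move=> AB; apply: le_ereal_inf_tmp => _ [U [oU BU] <-].
by apply: outer_mass_le => //; exact: subset_trans BU.
Qed.

Hypothesis K_compact : compact [set: K].
Hypothesis K_hausdorff : hausdorff_space K.

(** After a cut, [f] is split by a Urysohn function [h] equal to [0] off [U] and to [1] on the part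
    of [{f >= eps}] outside [V]: [t h] is subordinate to [U] and [t (1 - h)] to [V]. *)
Lemma inner_massU U V : open U -> open V ->
  inner_mass (U `|` V) <= inner_mass U + inner_mass V.
Proof.
move=> oU oV; apply: inner_mass_le => f [cf f01 f0].
apply/ler_addgt0Pr => eps eps0.
pose C := [set x | eps <= f x] `&` ~` V.
have cC : closed C by apply: closedI; [exact: closed_superlevel|exact: open_closedC].
have : uniform_separator (~` U) C.
  apply: ((@normal_separatorP R K).1 (compact_normal K_hausdorff K_compact)) => //.
    exact: open_closedC.
  rewrite -subset0 => x [nUx [/= epsf nVx]]; have /f0 fx0 : ~ (U `|` V) x by case.
  by move: epsf; rewrite fx0 leNgt eps0.
move=> /(@uniform_separatorP _ R)[h [ch h01 hU hC]].
have h01' x : 0 <= h x <= 1.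
  by have := h01 (h x); rewrite /= in_itv/=; apply; exists x.
pose t := cut eps f.
have ct : continuous t by exact: continuous_cut.
have t01 x : 0 <= t x <= 1.
  have /andP[fx0 fx1] := f01 x; rewrite cut_ge0/=.
  by apply: le_trans fx1; exact: cut_le (ltW eps0) fx0.
have c1h : continuous (fun x => 1 - h x).
  by move=> x; apply: cvgB (ch x); exact: cst_continuous.
have c1 : continuous (t \* h) by move=> x; exact: cvgM (ct x) (ch x).
have c2 : continuous (t \* (fun x => 1 - h x)).
  by move=> x; exact: cvgM (ct x) (c1h x).
have tE : t = (t \* h) \+ (t \* (fun x => 1 - h x)).
  by apply/funext => x /=; rewrite -mulrDr addrC subrK mulr1.
apply: le_trans (functional_cut eps cf) _; rewrite lerD2r -/t tE I_add//.
apply: lerD; apply: le_inner_mass; split => // x.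
- have /andP[? ?] := t01 x; have /andP[? ?] := h01' x.
  by rewrite /= mulr_ge0//= mulr_ile1.
- move=> nU; have hx0 : h x = 0 by apply: hU; exists x.
  by rewrite /= hx0 mulr0.
- have /andP[? ?] := t01 x; have /andP[? ?] := h01' x.
  by rewrite /= mulr_ge0 ?subr_ge0//= mulr_ile1 ?subr_ge0// gerBl.
- move=> nV /=; have [epsf|/cut_eq0 fx] := leP eps (f x); last first.
    by rewrite /t fx mul0r.
  have hx1 : h x = 1 by apply: hC; exists x.
  by rewrite hx1 subrr mulr0.
Qed.

Lemma inner_mass_bigsetU (F : nat -> set K) n : (forall i, open (F i)) ->
  inner_mass (\big[setU/set0]_(i < n) F i) <= \sum_(i < n) inner_mass (F i).
Proof.
move=> oF; elim: n => [|n IHn]; first by rewrite !big_ord0 inner_mass0.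
rewrite !big_ord_recr/=; apply: le_trans (lerD IHn (lexx _)).
by apply: inner_massU => //; rewrite -bigcup_mkord; exact: bigcup_open.
Qed.

(** By compactness finitely many [F i] cover [{f >= eps}], so the cut of [f] is subordinate to a
    finite union and finite subadditivity applies. *)
Lemma inner_mass_bigcup (F : nat -> set K) : (forall i, open (F i)) ->
  ((inner_mass (\bigcup_i F i))%:E <= \sum_(i <oo) (inner_mass (F i))%:E)%E.
Proof.
move=> oF.
have bnd f : subordinate (\bigcup_i F i) f ->
    ((I f)%:E <= \sum_(i <oo) (inner_mass (F i))%:E)%E.
  move=> [cf f01 f0]; apply/lee_addgt0Pr => eps eps0.
  pose C := [set x | eps <= f x].
  have /compact_near_coveringP cC : compact C.
    by apply: subclosed_compact K_compact _ => //; exact: closed_superlevel.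
  have [|N _ /(_ N (leqnn N)) CN] :=
      cC _ \oo (fun n x => (\bigcup_(i < n) F i) x) _.
    move=> x; rewrite /C/= => epsf.
    have [i _ Fix] : (\bigcup_i F i) x.
      by apply: contrapT => /f0 fx0; move: epsf; rewrite fx0 leNgt eps0.
    exists (F i, [set n | (i < n)%N]) => /=; last first.
      by move=> [y n] [/= Fiy ltin]; exists i.
    by split; [exact: open_nbhs_nbhs|exists i.+1].
  have cutN : subordinate (\bigcup_(i < N) F i) (cut eps f).
    split; first exact: continuous_cut.
      move=> x; have /andP[fx0 fx1] := f01 x; rewrite cut_ge0/=.
      by apply: le_trans fx1; exact: cut_le (ltW eps0) fx0.
    move=> x nx; apply: cut_eq0; rewrite ltNge; apply/negP => epsf.
    by apply: nx; exact: CN.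
  apply: (@le_trans _ _ (\sum_(i < N) (inner_mass (F i))%:E + eps%:E)%E).
    rewrite sumEFin -EFinD lee_fin; apply: le_trans (functional_cut eps cf) _.
    rewrite lerD2r; apply: le_trans (inner_mass_bigsetU N oF).
    by apply: le_inner_mass; rewrite -bigcup_mkord.
  rewrite leeD2r// -(big_mkord xpredT (fun i => (inner_mass (F i))%:E)).
  by apply: nneseries_lim_ge => i _; rewrite lee_fin inner_mass_ge0.
(* An infinite sum bounds everything; a finite one can be compared with the real supremum. *)
have [rE|] := eqVneq (\sum_(i <oo) (inner_mass (F i))%:E)%E +oo%E.
  by rewrite rE leey.
move=> nT; have sfin : (\sum_(i <oo) (inner_mass (F i))%:E)%E \is a fin_num.
  rewrite ge0_fin_numE ?ltey//; apply: nneseries_ge0 => i _ _.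
  by rewrite lee_fin inner_mass_ge0.
rewrite -(fineK sfin) lee_fin; apply: inner_mass_le => f /bnd.
by rewrite -{1}(fineK sfin) lee_fin.
Qed.

Lemma outer_mass_set0 : outer_mass set0 = 0%E.
Proof. by rewrite outer_mass_open ?inner_mass0//; exact: open0. Qed.

(** Each [A n] is enclosed in an open set at an excess of at most [eps / 2 ^ n.+1], which reduces
    the claim to open sets. *)
Lemma outer_mass_subadditive : sigma_subadditive outer_mass.
Proof.
move=> A; apply/lee_addgt0Pr => eps eps0.
have /choice[U UP] n : exists U, [/\ open U, A n `<=` U &
    ((inner_mass U)%:E <= outer_mass (A n) + (eps / (2 ^ n.+1)%:R)%:E)%E].
  have e0 : 0 < eps / (2 ^ n.+1)%:R by rewrite divr_gt0// ltr0n expn_gt0.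
  have [_ [U [oU AU] <-] /ltW ltU] := lb_ereal_inf_adherent e0 (outer_mass_fin (A n)).
  by exists U.
have oU n : open (U n) by case: (UP n).
apply: (@le_trans _ _ (inner_mass (\bigcup_n U n))%:E).
  apply: outer_mass_le; first exact: bigcup_open.
  by apply: subset_bigcup => n _; case: (UP n).
apply: le_trans (inner_mass_bigcup oU) _.
apply: le_trans (epsilon_trick _ _ (ltW eps0)); last first.
  by move=> n; exact: outer_mass_ge0.
apply: lee_nneseries => [n _ _|n _]; first by rewrite lee_fin inner_mass_ge0.
by case: (UP n).
Qed.

Definition outer_mass_measure : {outer_measure set K -> \bar R} :=
  HB.pack outer_mass (isOuterMeasure.Build R K outer_mass
    outer_mass_set0 outer_mass_ge0 outer_massS outer_mass_subadditive).

(** For open [V] containing [A], take [f] subordinate to the part of [V] in [U], and [g] subordinate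
    to [W], an open set containing the rest of [V]. Where [g] is nonzero the cut of [f] vanishes, so
    their sum is subordinate to [V]. *)
Lemma open_caratheodory U : open U -> outer_mass_measure.-caratheodory U.
Proof.
move=> oU; apply: le_caratheodory_measurable => A /=.
apply: le_ereal_inf_tmp => _ [V [oV AV] <-].
apply: (@le_trans _ _ (outer_mass (V `&` U) + outer_mass (V `&` ~` U))%E).
  by apply: leeD; apply: outer_massS; exact: setSI.
rewrite outer_mass_open; last exact: openI.
rewrite -(fineK (outer_mass_fin (V `&` ~` U))) -EFinD lee_fin.
rewrite -lerBrDr; apply: inner_mass_le => f [cf f01 f0].
apply/ler_addgt0Pr => eps eps0.
pose W := V `&` ~` [set x | eps <= f x].
have oW : open W.
  by apply: openI => //; apply: closed_openC; exact: closed_superlevel.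
have VUW : V `&` ~` U `<=` W.
  move=> x [Vx nUx]; split => //=; rewrite f0; last by case.
  by rewrite leNgt eps0.
have le_W : fine (outer_mass (V `&` ~` U)) <= inner_mass W.
  by rewrite -lee_fin fineK ?outer_mass_fin//; exact: outer_mass_le.
rewrite addrAC lerBrDr; apply: le_trans (lerD (lexx _) le_W) _.
rewrite [leLHS]addrC -lerBrDr; apply: inner_mass_le => g [cg g01 g0].
rewrite lerBrDr; apply: le_trans (lerD (lexx _) (functional_cut eps cf)) _.
rewrite addrA lerD2r -I_add//; last exact: continuous_cut.
apply: le_inner_mass; split.
- by move=> x; apply: cvgD; [exact: cg|exact: continuous_cut].
- move=> x /=; have /andP[? ?] := f01 x; have /andP[? ?] := g01 x.
  have [epsf|/cut_eq0 ->] := leP eps (f x); last by rewrite addr0; apply/andP.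
  rewrite g0 ?add0r; last by case.
  rewrite cut_ge0/=; apply: (@le_trans _ _ (f x)) => //.
  by apply: cut_le => //; exact: ltW.
- move=> x nVx /=; rewrite g0; last by case.
  by rewrite add0r cut_eq0// f0//; case.
Qed.

End PositiveFunctional.

(** * The Borel probability measure of a positive normalized functional *)

Section BorelProbability.
Context (R : realType) (K : ptopologicalType) (I : (K -> R) -> R).
Hypothesis I_add : forall f g : K -> R, continuous f -> continuous g ->
  I (f \+ g) = I f + I g.
Hypothesis I_ge0 : forall f : K -> R, continuous f ->
  (forall x, 0 <= f x) -> 0 <= I f.
Hypothesis I_cst : forall c, I (fun=> c) = c.
Hypothesis K_compact : compact [set: K].
Hypothesis K_hausdorff : hausdorff_space K.

Let mu : {outer_measure set K -> \bar R} :=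
  outer_mass_measure I_add I_ge0 I_cst K_compact K_hausdorff.

Let T := g_sigma_algebraType (@open K).

Lemma borel_caratheodory (A : set T) : measurable A -> mu.-caratheodory A.
Proof.
apply: smallest_sub A => [|U oU]; last exact: open_caratheodory.
split; first exact: caratheodory_measurable_set0.
- by move=> A mA; rewrite setTD; exact: caratheodory_measurable_setC.
- by move=> F mF; exact: caratheodory_measurable_bigcup.
Qed.

Lemma outer_mass_sigma_additive : semi_sigma_additive (outer_mass I : set T -> \bar R).
Proof.
move=> A mA tA mA'.
apply: (@caratheodory_measure_sigma_additive R K mu A) => //.
  by move=> n; exact: borel_caratheodory.
exact: borel_caratheodory.
Qed.

Lemma borel_outer_mass_ge0 (A : set T) : (0 <= outer_mass I A)%E.
Proof. exact: outer_mass_ge0. Qed.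

Definition riesz_measure : {measure set T -> \bar R} :=
  HB.pack (outer_mass I : set T -> \bar R)
   (isMeasure.Build _ T R (outer_mass I : set T -> \bar R)
     (outer_mass_set0 I_add I_ge0 I_cst) borel_outer_mass_ge0
     outer_mass_sigma_additive).

Lemma riesz_measureT : riesz_measure setT = 1%E.
Proof.
rewrite /riesz_measure /= (outer_mass_open I_add I_ge0 I_cst openT).
by rewrite (inner_massT I_add I_ge0 I_cst).
Qed.

(* The Riesz--Markov construction, without the integral representation. *)
Lemma riesz_probability :
  exists P : probability T R, P = outer_mass I :> (set T -> \bar R).
Proof.
pose P : probability T R :=
  HB.pack (outer_mass I : set T -> \bar R) riesz_measure
    (Measure_isProbability.Build _ T R riesz_measure riesz_measureT).
by exists P.
Qed.

End BorelProbability.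

(** A homeomorphism permutes the open sets and the functions subordinate to them, so invariance of
    [I] on functions into [[0, 1]] passes directly to the outer mass, with no integral. *)
Lemma outer_mass_preimage (R : realType) (K : topologicalType)
    (I : (K -> R) -> R) (s t : K -> K) :
  continuous s -> continuous t -> cancel s t -> cancel t s ->
  (forall f : K -> R, continuous f -> (forall x, 0 <= f x <= 1) ->
     I (f \o s) = I f) ->
  forall A, outer_mass I (s @^-1` A) = outer_mass I A.
Proof.
move=> cs ct st ts invI.
have sub (u v : K -> K) (U : set K) (f : K -> R) : continuous u ->
    cancel u v -> subordinate U f -> subordinate (u @^-1` U) (f \o u).
  move=> cu uv [cf f01 f0]; split=> x; [|exact: f01|exact: f0].
  by apply: continuous_comp; [exact: cu|exact: cf].
have inner U : inner_mass I (s @^-1` U) = inner_mass I U.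
  congr sup; apply/seteqP; split => _ [f fU <-]; last first.
    by exists (f \o s); [exact: (sub _ _ _ _ cs st)|apply: invI; case: fU].
  have ftU : subordinate U (f \o t).
    have := sub _ _ _ _ ct ts fU.
    by rewrite -comp_preimage (_ : s \o t = id)//; apply/funext.
  exists (f \o t) => //; rewrite -invI; [|by case: ftU..].
  by congr I; apply/funext => x /=; rewrite st.
move=> A; congr ereal_inf; apply/seteqP; split => _ [U [oU AU] <-].
  exists (t @^-1` U).
    split; first by apply: open_comp => // x _; exact: ct.
    by move=> x Ax; apply: AU; rewrite /= ts.
  rewrite -inner; congr (inner_mass I _)%:E.
  by rewrite -comp_preimage (_ : t \o s = id)//; apply/funext.
exists (s @^-1` U); last by rewrite inner.
split; first by apply: open_comp => // x _; exact: cs.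
by move=> x; exact: AU.
Qed.

(** * Approximate invariance *)

Section Homogeneity.
Context (L : language) (X : structure L).

(** An embedding of [A] is an isomorphism onto the substructure on its finite image [B], to which
    ultrahomogeneity applies. *)
Lemma extend_embedding (A : {fset X}) (e : embedding (substructure A) X) :
  ultrahomogeneous X ->
  exists g : automorphism X, forall a : A, g (fsval a) = e a.
Proof.
move=> hX.
pose B : {fset X} := [fset x in [seq (e : A -> X) a | a <- enum {: A}]]%fset.
have eB (a : substructure A) : e a \in B.
  by rewrite in_fset; apply/mapP; exists a; rewrite ?mem_enum.
have [h hE] := corestrict eB.
have hval a : fsval (h a) = e a by rewrite -hE.
have /choice[k kE] (b : B) : exists a : A, e a = fsval b.
  by have := fsvalP b; rewrite in_fset => /mapP[a _ ->]; exists a.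
have hbij : bijective h.
  have hk : cancel k h by move=> b; apply: val_inj; rewrite /= hval kE.
  by exists k => // a; apply: (embeddingP h).1; rewrite hk.
by have [g gE] := hX _ _ h hbij; exists g => a; rewrite gE hval.
Qed.

(** Pointwise stabilizers of finite sets generate a filter that converges to [1] pointwise, hence in
    the topology of the group. *)
Lemma nbhs_aut1 (V : set (automorphism X)) : nbhs (1%g : automorphism X) V ->
  exists A : {fset X}, forall v : automorphism X,
    (forall x, x \in A -> v x = x) -> V v.
Proof.
pose F := filter_from setT (fun A : {fset X} =>
  [set v : automorphism X | forall x, x \in A -> v x = x]).
have FF : Filter F.
  apply: filter_fromT_filter => [|A B]; first by exists fset0.
  exists (A `|` B)%fset => v vAB; split=> x xA; apply: vAB;
    by rewrite in_fsetU xA ?orbT.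
have F1 : F --> (1%g : automorphism X).
  by apply: cvg_aut => x; exists [fset x]%fset => // v; apply; rewrite inE.
by move=> /F1[A _ AV]; exists A => v vA; exact: AV.
Qed.

End Homogeneity.

(** Continuity of the action at [(1, y)] gives the bound near [y]; compactness of [K] makes one
    neighborhood of [1] serve all [y]. *)
Lemma action_near (R : realType) (G : topologicalGroupType) (K : topologicalType)
    (act : G -> K -> K) (f : K -> R) (eps : R) :
  compact [set: K] -> continuous_action act -> continuous f -> 0 < eps ->
  \forall v \near (1%g : G), forall y, `|f (act v y) - f y| <= eps.
Proof.
move=> /compact_near_coveringP cK [act1 _ cact] cf eps0.
have H y : [set: K] y -> \forall y' \near y & v \near (1%g : G),
    `|f (act v y') - f y'| <= eps.
  move=> _.
  have c1 : f (act p.2 p.1) @[p --> (y, 1%g : G)] --> f y.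
    have c0 : (fun p : K * G => (p.2, p.1)) @ (y, 1%g : G) --> (1%g : G, y).
      by apply: cvg_pair; [exact: cvg_snd|exact: cvg_fst].
    have c2 : act p.2 p.1 @[p --> (y, 1%g : G)] --> y.
      have := cvg_comp _ _ c0 (cact (1%g, y)); rewrite /= act1; exact.
    exact: cvg_comp c2 (cf y).
  have c3 : f p.1 @[p --> (y, 1%g : G)] --> f y.
    have c0 : (fun p : K * G => p.1) @ (y, 1%g : G) --> y by exact: cvg_fst.
    exact: cvg_comp c0 (cf y).
  have := cvgB c1 c3; rewrite subrr => /(_ _)/cvgr0Pnorm_le/(_ _ eps0).
  exact.
apply: filterS (cK _ _ (fun v y => `|f (act v y) - f y| <= eps) _ H) => v vP y.
exact: vP.
Qed.

Section ApproximateInvariance.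
Context (R : realType) (L : language) (X : structure L).
Hypothesis hX : ultrahomogeneous X.
Hypothesis ramsey : simultaneous_ramsey R X.
Context (K : topologicalType) (act : automorphism X -> K -> K).
Hypothesis cK : compact [set: K].
Hypothesis cact : continuous_action act.

(** A finitely supported measure is kept as a list of weighted points, in which points may
    repeat. *)
Definition expectation (nu : seq (R * K)) (f : K -> R) : R :=
  \sum_(p <- nu) p.1 * f p.2.

Definition finite_probability (nu : seq (R * K)) : Prop :=
  (forall p, p \in nu -> 0 <= p.1) /\ expectation nu (fun=> 1) = 1.

Definition unit_continuous (f : K -> R) : Prop :=
  continuous f /\ forall x, 0 <= f x <= 1.

Lemma approximately_invariant (x0 : K) (fs : seq ((K -> R) * automorphism X))
    (eps : R) : 0 < eps -> (forall p, p \in fs -> unit_continuous p.1) ->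
  exists2 nu, finite_probability nu & forall p, p \in fs ->
    `|expectation nu p.1 - expectation nu (p.1 \o act (p.2^-1)%g)| <= eps.
Proof.
(* Two uses of [close] and one oscillation bound will cost [d] each. *)
move=> eps0 fsP; pose d := eps / 3; have d0 : 0 < d by rewrite divr_gt0.
have [act1 actM _] := cact.
have : \forall v \near (1%g : automorphism X), forall p, p \in fs ->
    forall y, `|p.1 (act v y) - p.1 y| <= d.
  apply: filter_seq => p /fsP[cp _]; exact: action_near.
move=> /nbhs_aut1[A AP].
(* [B] contains [A] and its images under the given automorphisms, so both [1] and each [p.2]
   restrict to embeddings of [A] into [B]. *)
pose B : {fset X} := (A `|` [fset x in
  [seq (p.2 : automorphism X) x | p <- fs, x <- enum_fset A]])%fset.
have [C CP] := ramsey A B (size fs) d0.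
have /choice[h hE] (e : embedding (substructure A) (substructure C)) :
    exists g : automorphism X, forall a : A, g (fsval a) = fsval (e a).
  exact: (extend_embedding (embedding_comp (incl C) e) hX).
(* Automorphisms with the same restriction to [A] differ by [(h e)^-1 * k], which fixes [A]
   pointwise, so the value of [p.1] nearly depends on the restriction only. *)
have near_h p (e : embedding (substructure A) (substructure C))
    (k : automorphism X) : p \in fs ->
    (forall a : A, k (fsval a) = fsval (e a)) ->
    `|p.1 (act (h e)^-1%g x0) - p.1 (act k^-1%g x0)| <= d.
  move=> pfs ke.
  have -> : ((h e)^-1 = ((h e)^-1 * k) * k^-1)%g by rewrite mulgK.
  rewrite actM; apply: AP => // x xA.
  change ((h e)^-1%g (k x) = x); rewrite (ke [` xA]%fset) -hE.
  exact: aut_invK.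
pose f (i : 'I_(size fs)) (e : embedding (substructure A) (substructure C)) :=
  (tnth (in_tuple fs) i).1 (act (h e)^-1%g x0).
have [|b cb osc] := CP f.
  by move=> i e; have /fsP[_] := mem_tnth i (in_tuple fs); exact.
have /choice[k kE] (g : embedding (substructure B) (substructure C)) :
    exists k : automorphism X, forall a : B, k (fsval a) = fsval (g a).
  exact: (extend_embedding (embedding_comp (incl C) g) hX).
(* Each [g] in the support of [b] becomes a point of the orbit of [x0], with the same weight. *)
pose nu := [seq (coeff g b, act (k g)^-1%g x0) | g <- dom b].
have nuE u : expectation nu u = \sum_(g <- dom b) coeff g b * u (act (k g)^-1%g x0).
  by rewrite /expectation big_map.
exists nu.
  have [b0 b1] := cb; split; first by move=> _ /mapP[g _ ->]; exact: b0.
  by rewrite nuE -[RHS]b1; apply: eq_bigr => g _; rewrite mulr1.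
move=> p pfs.
(* [k g * u] extends [g o e] on [A], so [near_h] compares the two sides term by term. *)
have close (e : embedding (substructure A) (substructure B)) (u : automorphism X) :
    (forall a : A, u (fsval a) = fsval (e a)) ->
    `|average (fun e => p.1 (act (h e)^-1%g x0)) b e -
      expectation nu (p.1 \o act (u^-1)%g)| <= d.
  move=> ue; rewrite /average linear_extensionE nuE -sumrB.
  apply: le_trans (ler_norm_sum _ _ _) _.
  have [b0 b1] := cb; rewrite -[leRHS]mul1r -b1 mulr_suml.
  apply: ler_sum => g _; rewrite -mulrBr normrM ger0_norm//.
  apply: ler_wpM2l => //=; rewrite -actM -invgM.
  apply: near_h => // a.
  by change (k g (u (fsval a)) = fsval (g (e a))); rewrite ue kE.
have iotaP (u : automorphism X) : (forall x, x \in A -> u x \in B) ->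
    exists e : embedding (substructure A) (substructure B),
      forall a : A, u (fsval a) = fsval (e a).
  move=> uAB.
  have [a|e eE] := @corestrict _ _ _ B (embedding_comp u (incl A)).
    by apply: uAB; exact: fsvalP.
  exists e => a.
  exact: esym (congr1 (fun w : embedding (substructure A) X => w a) eE).
(* [e0] is the inclusion and [e1] the restriction of [p.2]; stability between them is near
   invariance under [p.2]. *)
have [|e0 e0E] := iotaP 1%g.
  by move=> x xA; rewrite in_fsetU; apply/orP; left.
have [|e1 e1E] := iotaP p.2.
  move=> x xA; rewrite in_fsetU; apply/orP; right.
  by rewrite in_fset; apply/allpairsP; exists (p, x).
have [i pE] : exists i, p = tnth (in_tuple fs) i.
  exact/tnthP.
have := osc i e0 e1; rewrite /f -pE.
have := close e0 1%g e0E; have := close e1 p.2 e1E.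
have -> : p.1 \o act (1^-1)%g = p.1.
  by apply/funext => y /=; rewrite invg1 act1.
rewrite /d !ler_norml => /andP[? ?] /andP[? ?] /andP[? ?].
by apply/andP; split; lra.
Qed.

End ApproximateInvariance.

(** * Invariant measures *)

(** The image ultrafilter has a cluster point in the compact segment, and an ultrafilter converges
    to each of its cluster points. *)
Lemma ultra_bounded_cvg (R : realType) (T : Type) (U : set_system T)
    (u : T -> R) (a b : R) : UltraFilter U ->
  U [set t | a <= u t <= b] -> cvg (u @ U).
Proof.
move=> UU Uab.
have [|p [_ clp]] := @segment_compact R a b (u @ U) (fmap_proper_filter u _).
  by apply: (@filterS _ U) Uab => t; rewrite /= in_itv.
apply/cvg_ex; exists p => V Vp /=.
have [//|UnV] := in_ultra_setVsetC (u @^-1` V) UU.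
by have [y [nVy Vy]] := clp (~` V) V UnV Vp.
Qed.

Section Expectation.
Context (R : realType) (K : topologicalType) (nu : seq (R * K)).

Lemma expectationD (f g : K -> R) :
  expectation nu (f \+ g) = expectation nu f + expectation nu g.
Proof.
by rewrite /expectation -big_split; apply: eq_bigr => p _; rewrite mulrDr.
Qed.

Hypothesis nuP : finite_probability nu.

Lemma expectation_cst c : expectation nu (fun=> c) = c.
Proof.
have [_] := nuP; rewrite /expectation => nu1; rewrite -[RHS]mul1r -nu1 mulr_suml.
by apply: eq_bigr => p _; rewrite mulr1.
Qed.

Lemma le_expectation (f g : K -> R) : (forall x, f x <= g x) ->
  expectation nu f <= expectation nu g.
Proof.
move=> fg; have [nu0 _] := nuP; rewrite /expectation !big_seq.
by apply: ler_sum => p pnu; apply: ler_wpM2l => //; exact: nu0.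
Qed.

End Expectation.

Lemma compact_continuous_bounded (R : realType) (K : topologicalType) (f : K -> R) :
  compact [set: K] -> continuous f -> exists M, forall x, - M <= f x <= M.
Proof.
move=> cK cf.
have /compact_bounded[M [_ MP]] : compact (range f).
  by apply: continuous_compact => //; exact: continuous_subspaceT.
exists (M + 1) => x; rewrite -ler_norml.
by apply: (MP (M + 1)); [rewrite ltrDl|exists x].
Qed.

(** * Limits of expectations along an ultrafilter *)

Section UltraLimit.
Context (R : realType) (K : topologicalType) (U : set_system (seq (R * K))).
Hypothesis UU : UltraFilter U.
Hypothesis UP : U (@finite_probability R K).
Hypothesis cK : compact [set: K].

Definition limit_expectation (f : K -> R) : R :=
  lim ((fun nu => expectation nu f) @ U).

Lemma limit_expectation_cvg (f : K -> R) : continuous f ->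
  (fun nu => expectation nu f) @ U --> limit_expectation f.
Proof.
move=> cf; have [M fM] := compact_continuous_bounded cK cf.
apply: (@ultra_bounded_cvg _ _ _ _ (- M) M) => //.
apply: filterS UP => nu nuP /=; apply/andP; split.
  rewrite -[leLHS](expectation_cst nuP); apply: le_expectation => // x.
  by case/andP: (fM x).
rewrite -[leRHS](expectation_cst nuP); apply: le_expectation => // x.
by case/andP: (fM x).
Qed.

Lemma limit_expectationD (f g : K -> R) : continuous f -> continuous g ->
  limit_expectation (f \+ g) = limit_expectation f + limit_expectation g.
Proof.
move=> cf cg; apply: cvg_lim => //.
have := cvgD (limit_expectation_cvg cf) (limit_expectation_cvg cg).
rewrite (_ : (_ + _) = fun nu => expectation nu (f \+ g)); first exact.
by apply/funext => nu /=; rewrite expectationD.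
Qed.

Lemma limit_expectation_cst c : limit_expectation (fun=> c) = c.
Proof.
apply: cvg_lim => //; apply: cvg_near_cst.
by apply: filterS UP => nu nuP; exact: expectation_cst.
Qed.

Lemma limit_expectation_ge0 (f : K -> R) : continuous f ->
  (forall x, 0 <= f x) -> 0 <= limit_expectation f.
Proof.
move=> cf f0; apply: limr_ge.
  by apply/cvg_ex; exists (limit_expectation f); exact: limit_expectation_cvg.
apply: filterS UP => nu nuP /=.
by rewrite -[leLHS](expectation_cst nuP); exact: le_expectation.
Qed.

Lemma limit_expectation_eq (f g : K -> R) : continuous f -> continuous g ->
  (forall n, U [set nu | `|expectation nu f - expectation nu g| <= n.+1%:R^-1]) ->
  limit_expectation f = limit_expectation g.
Proof.
move=> cf cg fg.
have FU : Filter U by typeclasses eauto.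
have cvfg := cvg_norm (cvgB (limit_expectation_cvg cf) (limit_expectation_cvg cg)).
have le_inv n : `|limit_expectation f - limit_expectation g| <= n.+1%:R^-1.
  rewrite -(cvg_lim _ (cvfg FU FU))//; apply: limr_le; last exact: fg.
  by apply/cvg_ex; eexists; exact: (cvfg FU FU).
apply/eqP; rewrite -subr_eq0 -normr_le0; apply/ler_addgt0Pr => e e0; rewrite add0r.
have [n ne] := ltr_add_invr (y := 0) (x := e) e0.
by apply: le_trans (le_inv n) _; rewrite add0r in ne; exact: ltW.
Qed.

End UltraLimit.

Section AmenableFromRamsey.
Context (R : realType) (L : language) (X : structure L).
Hypothesis hX : ultrahomogeneous X.
Hypothesis ramsey : simultaneous_ramsey R X.

Lemma ramsey_amenable : amenable R (automorphism X).
Proof.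
move=> K act cK hK cact.
(* A condition is a finite list of pairs with a precision; conditions are directed, by concatenation
   and maximum. Continuity is a premise inside, so that arbitrary lists are allowed. *)
pose bound (d : seq ((K -> R) * automorphism X) * nat) : set (seq (R * K)) :=
  [set nu | finite_probability nu /\ forall p, p \in d.1 -> unit_continuous p.1 ->
    `|expectation nu p.1 - expectation nu (p.1 \o act (p.2^-1)%g)| <= d.2.+1%:R^-1].
have F : ProperFilter (filter_from setT bound).
  apply: filter_from_proper.
    apply: filter_fromT_filter => [|d d']; first by exists ([::], 0%N).
    exists (d.1 ++ d'.1, maxn d.2 d'.2) => nu [nuP nud] /=.
    split; split => // p pd cp.
      apply: le_trans (nud p _ cp) _; first by rewrite mem_cat pd.
      by rewrite /= lef_pV2 ?posrE// ler_nat ltnS leq_maxl.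
    apply: le_trans (nud p _ cp) _; first by rewrite mem_cat pd orbT.
    by rewrite /= lef_pV2 ?posrE// ler_nat ltnS leq_maxr.
  move=> [fs n] _.
  have n0 : 0 < n.+1%:R^-1 :> R by rewrite invr_gt0.
  have [|nu nuP nufs] := approximately_invariant hX ramsey cK cact point
      (fs := [seq p <- fs | `[< unit_continuous p.1 >]]) n0.
    by move=> p; rewrite mem_filter => /andP[/asboolP].
  exists nu; split => // p pfs cp; apply: nufs.
  by rewrite mem_filter pfs andbT; exact/asboolP.
have [U [UU sU]] := ultraFilterLemma F.
have UP : U (@finite_probability R K).
  apply: filterS (sU _ (in_filter_from bound (I : setT ([::], 0%N)))) => nu [].
  by [].
pose J := limit_expectation U.
have [P PE] := riesz_probability (limit_expectationD UU UP cK)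
  (limit_expectation_ge0 UU UP cK) (limit_expectation_cst UU UP) cK hK.
have [act1 actM cont] := cact.
have actc g : continuous (act g).
  move=> x.
  have c0 : (fun y : K => (g, y)) @ x --> (g, x).
    have cg : (fun _ : K => g) @ x --> g by exact: cst_continuous.
    have ci : (fun y : K => y) @ x --> x by exact: cvg_id.
    exact: cvg_pair cg ci.
  exact: cvg_comp c0 (cont (g, x)).
exists P => g A mA; rewrite PE.
apply: (@outer_mass_preimage _ _ _ (act g) (act g^-1%g)) => //.
- by move=> x; rewrite -actM mulVg act1.
- by move=> x; rewrite -actM mulgV act1.
move=> f cf f01; apply/esym; apply: limit_expectation_eq => //.
  by move=> x; apply: continuous_comp; [exact: actc|exact: cf].
move=> n.
(* [bound] inverts the group element, so the pair with [g^-1] compares [f] with [f \o act g]. *)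
apply: filterS (sU _ (in_filter_from bound (I : setT ([:: (f, g^-1%g)], n)))).
move=> nu [_ /(_ (f, g^-1%g) (mem_head _ _) (conj cf f01))] /=.
by rewrite invgK.
Qed.

End AmenableFromRamsey.

(** * Orbit closures *)

Lemma measure_finType (d : measure_display) (T : ringOfSetsType d)
    (R : realFieldType) (mu : {measure set T -> \bar R}) (J : finType) (Q : pred J) (F : J -> set T) :
  (forall j, measurable (F j)) -> trivIset setT F ->
  mu (\bigcup_(j in [set j | Q j]) F j) = (\sum_(j | Q j) mu (F j))%E.
Proof.
move=> mF tF.
have -> : [set j | Q j] = [set` [seq j <- index_enum J | Q j]].
  by apply/seteqP; split => j /=; rewrite mem_filter mem_index_enum andbT.
rewrite measure_fin_bigcup//; last exact: sub_trivIset tF.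
by rewrite -fsbig_seq ?filter_uniq ?index_enum_uniq// big_filter.
Qed.

Section PatternSpace.
Context (E : choiceType) (C : set {ptws E -> bool}).

Lemma nbhs_ptws (phi : {ptws E -> bool}) e : nbhs phi [set psi | psi e = phi e].
Proof.
have eval_cont : continuous (fun f : {ptws E -> bool} => f e).
  exact: (@proj_continuous E (fun=> bool) e).
exact: (eval_cont phi) (discrete_set1 _).
Qed.

Lemma nbhs_pattern (k : set_type C) e : nbhs k [set h | set_val h e = set_val k e].
Proof.
have cval : continuous (set_val : set_type C -> {ptws E -> bool}).
  exact: initial_continuous.
exact: (cval k _ (nbhs_ptws (set_val k) e)).
Qed.

Lemma cvg_ptws (F : set_system {ptws E -> bool})
    (phi : {ptws E -> bool}) : Filter F ->
  (forall e, F [set psi | psi e = phi e]) -> F --> phi.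
Proof.
move=> FF Fphi; apply/cvg_sup => x; apply/cvg_image.
  by rewrite eqEsubset; split=> v // _; exists (cst v).
move=> A /principal_filterP Agx; exists [set f : E -> bool | A (f x)].
  by apply: filterS (Fphi x) => h /= ->.
by rewrite eqEsubset; split=> [_ [f Af <-]//|v Av]; exists (cst v).
Qed.

Lemma cvg_pattern (F : set_system (set_type C)) (k : set_type C) : Filter F ->
  (forall e, F [set h | set_val h e = set_val k e]) -> F --> k.
Proof.
move=> FF Fk.
have cvF : (set_val : set_type C -> {ptws E -> bool}) @ F --> set_val k.
  exact: cvg_ptws.
move=> A /= [_ [[B Bop <-] Bk sBA]].
have kB : nbhs (set_val k) B by exact: open_nbhs_nbhs.
exact: (@filterS _ F FF _ _ sBA (cvF _ kB)).
Qed.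

Lemma pattern_hausdorff : hausdorff_space (set_type C).
Proof.
move=> k k' kk'; apply: val_inj; apply/funext => e.
have [h [hk hk']] := kk' _ _ (nbhs_pattern k e) (nbhs_pattern k' e).
exact: etrans (esym hk) hk'.
Qed.

(** The full product is compact by Tychonoff, hence so is its closed subset [C]; the initial
    topology on the subtype turns a cluster point in [C] into one of the subtype. *)
Lemma pattern_compact : closed C -> compact [set: set_type C].
Proof.
move=> clC.
have cT : compact [set: {ptws E -> bool}].
  have := @tychonoff E (fun=> bool) (fun=> setT) (fun=> bool_compact).
  by rewrite (_ : [set _ | _] = setT)//; apply/seteqP; split.
have cC : compact C by exact: subclosed_compact clC cT _.
move=> F FF _.
have FC : (set_val @ F) C by apply: (@filterS _ F) filterT => k _; exact: set_valP.
have [phi [Cphi clphi]] := cC _ (fmap_proper_filter set_val FF) FC.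
exists (SigSub (mem_set Cphi)); split => // A B FA [_ [[W oW <-] Wphi sWB]].
have [||psi [[k Ak <-] Wpsi]] := clphi (set_val @` A) W.
- by apply: (@filterS _ F) FA => k Ak; exists k.
- exact: open_nbhs_nbhs.
by exists k; split => //; exact: sWB.
Qed.

Lemma pattern_clopen e (b : bool) : open [set k : set_type C | set_val k e = b].
Proof.
by rewrite openE => k /= <-; exact: nbhs_pattern.
Qed.

End PatternSpace.

Section OrbitClosure.
Context (L : language) (X : structure L) (A : {fset X}).
Let E := embedding (substructure A) X.
Context (f : E -> bool).

(** Precomposition with the inverse makes this a left action. *)
Definition translate (g : automorphism X) (phi : E -> bool) (e : E) : bool :=
  phi (embedding_comp (g^-1)%g e).

(* The closure of the orbit of [f], spelled out on finite sets of coordinates. *)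
Definition orbit_closure : set {ptws E -> bool} :=
  [set phi : {ptws E -> bool} | forall s : seq E, exists g,
    forall e, e \in s -> phi e = translate g f e].

Lemma closed_orbit_closure : closed orbit_closure.
Proof.
move=> phi clphi s.
have : nbhs phi [set psi : {ptws E -> bool} | forall e, e \in s -> psi e = phi e].
  by apply: (@filter_seq _ _ _ _
      (fun e => [set psi : {ptws E -> bool} | psi e = phi e]))
    => e _; exact: nbhs_ptws.
move=> /clphi[psi [/(_ s)[g gP] psiE]]; exists g => e es.
by rewrite -psiE// gP.
Qed.

Lemma translate1 phi : translate 1%g phi = phi.
Proof.
by apply/funext => e; congr phi; apply: embedding_ext => a /=; rewrite invg1.
Qed.

Lemma translateM g h phi : translate (g * h)%g phi = translate g (translate h phi).
Proof.
apply/funext => e; congr phi; apply: embedding_ext => a.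
change ((g * h)^-1%g (e a) = (h^-1 * g^-1)%g (e a)).
by rewrite invgM.
Qed.

Lemma orbit_closure_base : orbit_closure f.
Proof. by move=> s; exists 1%g => e _; rewrite translate1. Qed.

Lemma orbit_closure_translate g phi : orbit_closure phi ->
  orbit_closure (translate g phi).
Proof.
move=> Cphi s; have [h hP] := Cphi [seq embedding_comp (g^-1)%g e | e <- s].
exists (g * h)%g => e es; rewrite translateM /translate hP//.
by apply/mapP; exists e.
Qed.

(** Pointed by [f] itself, since [amenable] ranges over pointed spaces. *)
Definition orbit_space := set_type orbit_closure.
HB.instance Definition _ := Topological.on orbit_space.
HB.instance Definition _ := isPointed.Build orbit_space
  (SigSub (mem_set orbit_closure_base)).

Definition orbit_action (g : automorphism X) (k : orbit_space) : orbit_space :=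
  SigSub (mem_set (orbit_closure_translate g (set_valP k))).

(** Coordinate [e] of the translate depends on [g^-1] only along the finite image of [e], and on a
    single coordinate of [k], so it is locally constant. *)
Lemma continuous_orbit_action : continuous_action orbit_action.
Proof.
split=> [k|g h k|[g k]].
- by apply: val_inj; exact: translate1.
- by apply: val_inj; exact: translateM.
apply: cvg_pattern => e.
pose same_inv (h : automorphism X) := forall a : A, h^-1%g (e a) = g^-1%g (e a).
have near_g : nbhs g same_inv.
  have : nbhs g [set h : automorphism X |
      forall a, a \in enum {: A} -> h^-1%g (e a) = g^-1%g (e a)].
    apply: (@filter_seq _ _ _ _ (fun a : A =>
      [set h : automorphism X | h^-1%g (e a) = g^-1%g (e a)])) => a _.
    apply: filterS (nbhs_aut g (g^-1%g (e a))) => h /= hE.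
    by apply: (can_inj (aut_invK h)); rewrite [RHS]hE !aut_Kinv.
  by apply: filterS => h hP a; apply: hP; rewrite mem_enum.
exists (same_inv,
        [set h : orbit_space | set_val h (embedding_comp (g^-1)%g e) =
                               set_val k (embedding_comp (g^-1)%g e)]).
  by split => //; exact: nbhs_pattern.
move=> [h l] [/= hE lE].
rewrite -[RHS]lE; congr (set_val l _).
by apply: embedding_ext => a; exact: hE.
Qed.

Lemma compact_orbit_space : compact [set: orbit_space].
Proof. exact: pattern_compact closed_orbit_closure. Qed.

Lemma hausdorff_orbit_space : hausdorff_space orbit_space.
Proof. exact: pattern_hausdorff. Qed.

End OrbitClosure.

(** * Stabilizing a coloring by means of an invariant measure *)

Section RamseyFromAmenable.
Context (R : realType) (L : language) (X : structure L).
Hypothesis hX : ultrahomogeneous X.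
Hypothesis aX : amenable R (automorphism X).

Lemma amenable_ramsey (A B : {fset X}) (f : embedding (substructure A) X -> 'I_2) :
  stabilizes (substructure B) (fun e => (f e)%:R : R) (1 / 2).
Proof.
pose fb e := f e == 1; pose K := orbit_space fb.
have [mu muI] := aX
  (@compact_orbit_space _ _ _ fb) (@hausdorff_orbit_space _ _ _ fb)
  (@continuous_orbit_action _ _ _ fb).
pose T := g_sigma_algebraType (@open K).
have mval e b : measurable ([set k : K | set_val k e = b] : set T).
  by apply: sub_sigma_algebra; exact: pattern_clopen.
have /finite_seqP[s sE] := finite_embeddings A B.
pose c i : embedding (substructure A) X :=
  embedding_comp (incl B) (tnth (in_tuple s) i).
(* The cells, one for each pattern on the embeddings of [A] into [B], partition the space. *)
pose cell (p : {ffun 'I_(size s) -> bool}) : set T :=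
  [set k : K | forall i, set_val k (c i) = p i].
have mcell p : measurable (cell p).
  rewrite (_ : cell p = \bigcap_(i in [set: 'I_(size s)])
      [set k : K | set_val k (c i) = p i]).
    apply: (@fin_bigcap_measurable _ T) => [|i _]; first exact: finite_finset.
    exact: mval.
  by apply/seteqP; split => k kp i; [move=> _|]; exact: kp.
have tcell : trivIset setT cell.
  move=> p q _ _ [k [kp kq]]; apply/ffunP => i; exact: etrans (esym (kp i)) (kq i).
pose w p := fine (mu (cell p)).
have wE p : mu (cell p) = (w p)%:E by rewrite fineK// fin_num_measure.
have w0 p : 0 <= w p by rewrite fine_ge0.
have sumw (Q : pred {ffun 'I_(size s) -> bool}) :
    mu (\bigcup_(p in [set p | Q p]) cell p) = (\sum_(p | Q p) w p)%:E.
  by rewrite measure_finType// -sumEFin; apply: eq_bigr => p _; exact: wE.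
have w1 : \sum_p w p = 1.
  apply: EFin_inj; rewrite -sumw -(@probability_setT _ _ _ mu); congr (mu _).
  apply/seteqP; split => // k _; exists [ffun i => set_val k (c i)] => // i.
  by rewrite ffunE.
(* A cell of nonzero mass contains a point of the orbit closure, which agrees on finitely many
   coordinates with a translate of [f]. Empty cells have weight [0], so the default [1] is harmless
   there. *)
have /choice[g gP] (p : {ffun 'I_(size s) -> bool}) : exists g : automorphism X,
    w p != 0 -> forall i, fb (embedding_comp (g^-1)%g (c i)) = p i.
  have [[k kp]|cell0] := pselect (cell p !=set0).
    have [g gk] := set_valP k [seq c i | i <- enum 'I_(size s)].
    exists g => _ i; rewrite -kp; apply/esym/gk.
    by apply/mapP; exists i; rewrite ?mem_enum.
  exists 1%g; rewrite /w (_ : cell p = set0) ?measure0 ?eqxx//.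
  by apply: contrapT => /eqP/set0P.
(* [h' * h^-1] carries [e] to [e'], and [mu] is invariant under it. *)
have muD (e e' : embedding (substructure A) X) :
    mu [set k : K | set_val k e = true] = mu [set k : K | set_val k e' = true].
  have [h hE] := extend_embedding e hX; have [h' hE'] := extend_embedding e' hX.
  have e'E : embedding_comp (h' * h^-1)^-1%g e' = e.
    apply: embedding_ext => a; rewrite invgM invgK.
    change (h (h'^-1%g (e' a)) = e a).
    by rewrite -hE' [X in h X]aut_invK hE.
  by rewrite -(muI (h' * h^-1)%g _ (mval e' true)) -[in LHS]e'E.
apply/stabilizesP; exists (\sum_p << w p *g embedding_comp (g p)^-1%g (incl B) >>).
  exact: convex_combinations_sum.
(* The average at [i] sums the weights of the patterns with [p i] true. This is the mass of the
   union of their cells, and by [muD] it is the same for all [i]. *)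
have avgE i : (average (fun e => (f e)%:R : R)
    (\sum_p << w p *g embedding_comp (g p)^-1%g (incl B) >>) (tnth (in_tuple s) i))%:E =
    mu [set k : K | set_val k (c i) = true].
  have -> : [set k : K | set_val k (c i) = true] =
      \bigcup_(p in [set p : {ffun 'I_(size s) -> bool} | p i]) cell p.
    apply/seteqP; split => [k ki|k [p pi kp]]; last by rewrite /= kp.
    by exists [ffun i => set_val k (c i)] => [|j]; rewrite /= ffunE.
  rewrite sumw; congr EFin; rewrite /average linear_extension_sum [RHS]big_mkcond/=.
  apply: eq_bigr => p _; have [->|wp] := eqVneq (w p) 0.
    by rewrite mul0r if_same.
  have := gP p wp i; rewrite /fb => <-.
  rewrite (_ : embedding_comp _ _ = embedding_comp (g p)^-1%g (c i)); last first.
    exact: embedding_ext.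
  by case: (f _) => -[|[|//]] ?; rewrite /= ?mulr0 ?mulr1.
move=> e e'.
have mem_s x : exists i, x = tnth (in_tuple s) i.
  have : [set: embedding (substructure A) (substructure B)] x by [].
  by rewrite sE /= => xs; apply/tnthP.
have [i ->] := mem_s e; have [i' ->] := mem_s e'.
have := muD (c i) (c i'); rewrite -!avgE => -[->].
by rewrite subrr normr0 divr_ge0.
Qed.

End RamseyFromAmenable.

Theorem theorem6p1 (R : realType) (L : language) (X : structure L) (hX : fraisse X) :
  [<->
    forall (A B : {fset X}) (f : embedding (substructure A) X -> 'I_2),
      exists2 b, convex_combinations R (substructure B) X b &
        forall a a', convex_copies (substructure A) b a ->
                     convex_copies (substructure A) b a' ->
          `|linear_extension (fun e => (f e)%:R) a -
            linear_extension (fun e => (f e)%:R) a'| <= 1 / 2;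

    age_convex_ramsey R X;

    exists2 p : R, p < 1 &
      forall A B : {fset X}, exists C : {fset X},
        forall f : embedding (substructure A) (substructure C) -> R,
          (forall e, 0 <= f e <= 1) ->
          exists2 b, convex_combinations R (substructure B) (substructure C) b &
            forall a a', convex_copies (substructure A) b a ->
                         convex_copies (substructure A) b a' ->
              `|linear_extension f a - linear_extension f a'| <= p;

    forall (A B : {fset X}) (eps : R), 0 < eps -> exists C : {fset X},
      forall f : embedding (substructure A) (substructure C) -> R,
        (forall e, 0 <= f e <= 1) ->
        exists2 b, convex_combinations R (substructure B) (substructure C) b &
          forall a a', convex_copies (substructure A) b a ->
                       convex_copies (substructure A) b a' ->
            `|linear_extension f a - linear_extension f a'| <= eps;

    forall (A B : {fset X}) (eps : R) (n : nat), 0 < eps ->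
      exists C : {fset X},
        forall f : 'I_n -> embedding (substructure A) (substructure C) -> R,
          (forall i e, 0 <= f i e <= 1) ->
          exists2 b, convex_combinations R (substructure B) (substructure C) b &
            forall a a', convex_copies (substructure A) b a ->
                         convex_copies (substructure A) b a' ->
              forall i : 'I_n,
                `|linear_extension (f i) a - linear_extension (f i) a'| <= eps;

    amenable R (automorphism X)
  ].
Proof.
have [_ homX] := hX.
tfae.
- exact: infinite_to_finite_ramsey.
- move=> arrows; exists (3 / 4); first lra.
  move=> A B; have [C CP] := arrows A B; exists C => f f01.
  exact: stabilizes_round f01.
- by move=> [p p1 stab] A B eps eps0; exact: (stable_age_small p1 stab eps0).
- move=> stab A B eps n eps0.
  have [C CP] := stable_age_family (fun A' B' => stab A' B' eps eps0) n A B.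
  exists C => f f01; have [b cb osc] := CP f f01; exists b => // a a' ba ba' i.
  by apply: (proj2 (convex_copies_osc (f i) b eps)) ba ba' => e e'; exact: osc.
- move=> ramsey; apply: (ramsey_amenable homX) => A B eps n eps0.
  have [C CP] := ramsey A B eps n eps0; exists C => f f01.
  have [b cb osc] := CP f f01; exists b => // i.
  by apply/convex_copies_osc => a a' ba ba'; exact: osc.
- by move=> aX A B f; exact: (amenable_ramsey homX aX).
Qed.
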